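(* Let $N^{2n+1}(c)$ be a Sasakian space form with constant $\varphi$-sectional curvature $c\leq\frac{3-3n}{n+3}$. Then a compact $n$-dimensional integral submanifold $M^{n}$ of $N^{2n+1}(c)$ is biharmonic if and only if it is minimal.
   Context: Everything is smooth; manifolds are connected. A contact metric structure on $N^{2n+1}$ is $(\varphi,\xi,\eta,g)$ with $\varphi$ a $(1,1)$-tensor field, $\xi$ a vector field, $\eta$ a 1-form, $g$ a Riemannian metric such that $\varphi^2=-I+\eta\otimes\xi$, $\eta(\xi)=1$, $g(\varphi U,\varphi V)=g(U,V)-\eta(U)\eta(V)$, $g(U,\varphi V)=d\eta(U,V)$. It is Sasakian if $(\nabla^N_U\varphi)(V)=g(U,V)\xi-\eta(V)U$ for all vector fields $U,V$; then $\nabla^N_U\xi=-\varphi U$. The $\varphi$-sectional curvature is the sectional curvature of the planes spanned by $U,\varphi U$ with $U$ a unit vector orthogonal to $\xi$; a Sasakian space form $N(c)$ is a Sasakian manifold with constant $\varphi$-sectional curvature $c$. An integral submanifold $M$ of $N$ is a submanifold (with induced metric) with $\eta(X)=0$ for all $X$ tangent to $M$. $H=\frac1n\operatorname{trace}B$ is its mean curvature vector field, $B$ being the second fundamental form; $M$ is minimal if $H=0$. A map $\psi:(M,g)\to(N,h)$ is biharmonic if it is a critical point of the bienergy $E_2(\psi)=\frac12\int_M|\tau(\psi)|^2v_g$, $\tau(\psi)=\operatorname{trace}\nabla d\psi$; equivalently $\tau_2(\psi)=-\Delta\tau(\psi)-\operatorname{trace}R^N(d\psi,\tau(\psi))d\psi=0$,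 with $\Delta=-\operatorname{trace}\nabla^2$ the rough Laplacian. A submanifold is biharmonic if its inclusion map is biharmonic. *)

(* Defs.v *)
(* Riemannian, contact metric and Sasakian geometry on smooth manifolds, in
   classical tensor notation, over MathComp-Analysis.

   A point of a coordinate domain, a tangent vector, ... is a row vector; the
   differential of f at x applied to u is the directional derivative
   ['D_u f x]; a (1,1)-tensor A acts on vectors by [u *m A]; a bilinear form G
   by [u *m G *m v^T].  Tensor fields on a manifold are given by their
   components in each chart of the atlas, related on overlaps by the
   differentials of the transition maps.  Every equation between tensors is
   required at all points of all charts. *)
From HB Require Import structures.
From mathcomp Require Import all_boot all_order all_algebra.
From mathcomp Require Import all_classical all_reals all_analysis.

Set Implicit Arguments.
Unset Strict Implicit.
Unset Printing Implicit Defensive.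

Import Order.TTheory GRing.Theory Num.Theory.
Import numFieldNormedType.Exports.

Local Open Scope classical_set_scope.
Local Open Scope ring_scope.

(* On an open subset of a finite-dimensional space this is the usual class C^k:
   a function with continuous partial derivatives is differentiable. *)
Fixpoint Ck {R : realType} {V W : normedModType R} (k : nat)
    (U : set V) (f : V -> W) : Prop :=
  match k with
  | 0 => forall x, U x -> {for x, continuous f}
  | k'.+1 => (forall x, U x -> differentiable f x) /\
             (forall v, Ck k' U ('D_v f))
  end.

Definition smooth {R : realType} {V W : normedModType R}
    (U : set V) (f : V -> W) : Prop := forall k, Ck k U f.

Definition basis_vec {R : realType} {m : nat} (i : 'I_m) : 'rV[R]_m :=
  delta_mx 0 i.

Definition inner {R : realType} {m : nat} (A : 'M[R]_m) (u v : 'rV[R]_m) : R :=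
  (u *m A *m v^T) 0 0.

(* The value at v of the 1-form with components w. *)
Definition pairing {R : realType} {m : nat} (w : 'cV[R]_m) (v : 'rV[R]_m) : R :=
  (v *m w) 0 0.

(* Trace of a bilinear map T with respect to the inner product A. *)
Definition mtrace {R : realType} {m : nat} {W : lmodType R} (A : 'M[R]_m)
    (T : 'rV[R]_m -> 'rV[R]_m -> W) : W :=
  \sum_i \sum_j (invmx A) i j *: T (basis_vec i) (basis_vec j).

(* Gamma^k_ij; indices are passed in the order i j k *)
Definition christoffel {R : realType} {m : nat} (G : 'rV[R]_m -> 'M[R]_m)
    (x : 'rV[R]_m) (i j k : 'I_m) : R :=
  2^-1 * \sum_l (invmx (G x)) k l *
    ('D_(basis_vec i) (fun y => G y j l) x
     + 'D_(basis_vec j) (fun y => G y i l) x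
     - 'D_(basis_vec l) (fun y => G y i j) x).

Definition gamma {R : realType} {m : nat} (G : 'rV[R]_m -> 'M[R]_m)
    (x u v : 'rV[R]_m) : 'rV[R]_m :=
  \row_k \sum_i \sum_j u 0 i * v 0 j * christoffel G x i j k.

(* Levi-Civita connection: covD G X Y is nabla_X Y. *)
Definition covD {R : realType} {m : nat} (G : 'rV[R]_m -> 'M[R]_m)
    (X Y : 'rV[R]_m -> 'rV[R]_m) (x : 'rV[R]_m) : 'rV[R]_m :=
  'D_(X x) Y x + gamma G x (X x) (Y x).

Definition lie_bracket {R : realType} {m : nat} (X Y : 'rV[R]_m -> 'rV[R]_m)
    (x : 'rV[R]_m) : 'rV[R]_m :=
  'D_(X x) Y x - 'D_(Y x) X x.

(* R(X,Y)Z = nabla_X nabla_Y Z - nabla_Y nabla_X Z - nabla_[X,Y] Z *)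
Definition curvature {R : realType} {m : nat} (G : 'rV[R]_m -> 'M[R]_m)
    (X Y Z : 'rV[R]_m -> 'rV[R]_m) (x : 'rV[R]_m) : 'rV[R]_m :=
  covD G X (covD G Y Z) x - covD G Y (covD G X Z) x
  - covD G (lie_bracket X Y) Z x.

(* The curvature tensor at x: vectors are extended to vector fields with
   constant components, which is harmless since R is tensorial. *)
Definition riemann {R : realType} {m : nat} (G : 'rV[R]_m -> 'M[R]_m)
    (x u v w : 'rV[R]_m) : 'rV[R]_m :=
  curvature G (fun=> u) (fun=> v) (fun=> w) x.

Definition sectional {R : realType} {m : nat} (G : 'rV[R]_m -> 'M[R]_m)
    (x u v : 'rV[R]_m) : R :=
  inner (G x) (riemann G x u v v) u /
  (inner (G x) u u * inner (G x) v v - inner (G x) u v ^+ 2).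

(* d eta (U,V) = (U(eta V) - V(eta U) - eta [U,V]) / 2.  With the factor 1/2,
   the equation g(U, phi V) = d eta (U,V) is the one compatible with
   nabla_U xi = - phi U on Sasakian manifolds. *)
Definition ext_deriv {R : realType} {m : nat} (w : 'rV[R]_m -> 'cV[R]_m)
    (U V : 'rV[R]_m -> 'rV[R]_m) (x : 'rV[R]_m) : R :=
  2^-1 * ('D_(U x) (fun y => pairing (w y) (V y)) x
          - 'D_(V x) (fun y => pairing (w y) (U y)) x
          - pairing (w x) (lie_bracket U V x)).

(* Connection of the pull-back bundle: nabla_X V for a section V along f. *)
Definition covD_along {R : realType} {n m : nat} (H : 'rV[R]_m -> 'M[R]_m)
    (f : 'rV[R]_n -> 'rV[R]_m) (X : 'rV[R]_n -> 'rV[R]_n)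
    (V : 'rV[R]_n -> 'rV[R]_m) (x : 'rV[R]_n) : 'rV[R]_m :=
  'D_(X x) V x + gamma H (f x) ('D_(X x) f x) (V x).

(* (nabla df)(X,Y) = nabla_X (df Y) - df (nabla_X Y) *)
Definition nabla_df {R : realType} {n m : nat} (G : 'rV[R]_n -> 'M[R]_n)
    (H : 'rV[R]_m -> 'M[R]_m) (f : 'rV[R]_n -> 'rV[R]_m)
    (X Y : 'rV[R]_n -> 'rV[R]_n) (x : 'rV[R]_n) : 'rV[R]_m :=
  covD_along H f X (fun y => 'D_(Y y) f y) x - 'D_(covD G X Y x) f x.

Definition tension {R : realType} {n m : nat} (G : 'rV[R]_n -> 'M[R]_n)
    (H : 'rV[R]_m -> 'M[R]_m) (f : 'rV[R]_n -> 'rV[R]_m)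
    (x : 'rV[R]_n) : 'rV[R]_m :=
  mtrace (G x) (fun u v => nabla_df G H f (fun=> u) (fun=> v) x).

(* Rough Laplacian on sections along f: Delta = - trace nabla^2, where
   nabla^2_{X,Y} V = nabla_X nabla_Y V - nabla_{nabla_X Y} V. *)
Definition rough_laplacian {R : realType} {n m : nat}
    (G : 'rV[R]_n -> 'M[R]_n) (H : 'rV[R]_m -> 'M[R]_m)
    (f : 'rV[R]_n -> 'rV[R]_m) (V : 'rV[R]_n -> 'rV[R]_m)
    (x : 'rV[R]_n) : 'rV[R]_m :=
  - mtrace (G x) (fun u v =>
      covD_along H f (fun=> u) (covD_along H f (fun=> v) V) x
      - covD_along H f (covD G (fun=> u) (fun=> v)) V x).

(* tau_2 = - Delta tau - trace R(df, tau) df *)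
Definition bitension {R : realType} {n m : nat} (G : 'rV[R]_n -> 'M[R]_n)
    (H : 'rV[R]_m -> 'M[R]_m) (f : 'rV[R]_n -> 'rV[R]_m)
    (x : 'rV[R]_n) : 'rV[R]_m :=
  - rough_laplacian G H f (tension G H f) x
  - mtrace (G x) (fun u v =>
      riemann H (f x) ('D_u f x) (tension G H f x) ('D_v f x)).

(* Component of w normal to the image of df, when G is the metric induced by
   H: w minus its H-orthogonal projection on the tangent space. *)
Definition normal_part {R : realType} {n m : nat} (G : 'rV[R]_n -> 'M[R]_n)
    (H : 'rV[R]_m -> 'M[R]_m) (f : 'rV[R]_n -> 'rV[R]_m)
    (x : 'rV[R]_n) (w : 'rV[R]_m) : 'rV[R]_m :=
  w - mtrace (G x) (fun u v => inner (H (f x)) w ('D_u f x) *: 'D_v f x).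

(* B(X,Y), the normal component of nabla^N_X Y *)
Definition second_ff {R : realType} {n m : nat} (G : 'rV[R]_n -> 'M[R]_n)
    (H : 'rV[R]_m -> 'M[R]_m) (f : 'rV[R]_n -> 'rV[R]_m)
    (X Y : 'rV[R]_n -> 'rV[R]_n) (x : 'rV[R]_n) : 'rV[R]_m :=
  normal_part G H f x (covD_along H f X (fun y => 'D_(Y y) f y) x).

Definition mean_curvature {R : realType} {n m : nat} (G : 'rV[R]_n -> 'M[R]_n)
    (H : 'rV[R]_m -> 'M[R]_m) (f : 'rV[R]_n -> 'rV[R]_m)
    (x : 'rV[R]_n) : 'rV[R]_m :=
  n%:R^-1 *: mtrace (G x) (fun u v => second_ff G H f (fun=> u) (fun=> v) x).

(* Connected smooth manifolds without boundary, presented by a smooth atlas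
   (not necessarily the maximal one). *)
Record manifold (R : realType) (m : nat) := Manifold {
  carrier :> topologicalType;
  chart : Type;
  dom : chart -> set carrier;
  coord : chart -> carrier -> 'rV[R]_m;
  point : chart -> 'rV[R]_m -> carrier; (* inverse of coord *)
  manifold_hausdorff : hausdorff_space carrier;
  manifold_second_countable : @second_countable carrier;
  manifold_connected : connected [set: carrier];
  dom_cover : forall p, exists a, dom a p;
  dom_open : forall a, open (dom a);
  img_open : forall a, open (coord a @` dom a);
  coordK : forall a p, dom a p -> point a (coord a p) = p;
  coord_continuous : forall a p, dom a p -> {for p, continuous (coord a)};
  point_continuous : forall a x, (coord a @` dom a) x ->
    {for x, continuous (point a)};
  transition_smooth : forall a b,
    smooth (coord a @` (dom a `&` dom b)) (coord b \o point a) }.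

Arguments chart {R m}.
Arguments dom {R m} M a _ : rename.
Arguments coord {R m} M a _ : rename.
Arguments point {R m} M a _ : rename.

Definition img {R : realType} {m : nat} (M : manifold R m) (a : chart M) :
  set 'rV[R]_m := coord M a @` dom M a.

(* Change of components of tangent vectors at p from chart a to chart b. *)
Definition change {R : realType} {m : nat} (M : manifold R m) (a b : chart M)
    (p : M) (u : 'rV[R]_m) : 'rV[R]_m :=
  'D_u (coord M b \o point M a) (coord M a p).

Record vector_field (R : realType) (m : nat) (M : manifold R m) := VectorField {
  vf :> chart M -> 'rV[R]_m -> 'rV[R]_m;
  vf_smooth : forall a, smooth (img a) (vf a);
  vf_change : forall a b p, dom M a p -> dom M b p ->
    vf b (coord M b p) = change a b p (vf a (coord M a p)) }.

Record one_form (R : realType) (m : nat) (M : manifold R m) := OneForm {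
  form :> chart M -> 'rV[R]_m -> 'cV[R]_m;
  form_smooth : forall a, smooth (img a) (form a);
  form_change : forall a b p u, dom M a p -> dom M b p ->
    pairing (form b (coord M b p)) (change a b p u) =
    pairing (form a (coord M a p)) u }.

Record tensor11 (R : realType) (m : nat) (M : manifold R m) := Tensor11 {
  endo :> chart M -> 'rV[R]_m -> 'M[R]_m;
  endo_smooth : forall a, smooth (img a) (endo a);
  endo_change : forall a b p u, dom M a p -> dom M b p ->
    change a b p u *m endo b (coord M b p) =
    change a b p (u *m endo a (coord M a p)) }.

Record metric (R : realType) (m : nat) (M : manifold R m) := Metric {
  met :> chart M -> 'rV[R]_m -> 'M[R]_m;
  met_smooth : forall a, smooth (img a) (met a);
  met_change : forall a b p u v, dom M a p -> dom M b p ->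
    inner (met b (coord M b p)) (change a b p u) (change a b p v) =
    inner (met a (coord M a p)) u v;
  met_sym : forall a x u v, img a x ->
    inner (met a x) u v = inner (met a x) v u;
  met_pos : forall a x u, img a x -> u != 0 -> 0 < inner (met a x) u u }.

(* In each chart U and V range over all smooth vector fields on the chart. *)
Record contact_metric (R : realType) (n : nat) (N : manifold R n.*2.+1) :=
  ContactMetric {
  cm_phi : tensor11 N;
  cm_xi : vector_field N;
  cm_eta : one_form N;
  cm_g : metric N;
  cm_phi2 : forall a x u, img a x ->
    u *m cm_phi a x *m cm_phi a x =
    - u + pairing (cm_eta a x) u *: cm_xi a x;
  cm_eta_xi : forall a x, img a x -> pairing (cm_eta a x) (cm_xi a x) = 1;
  cm_compat : forall a x u v, img a x ->
    inner (cm_g a x) (u *m cm_phi a x) (v *m cm_phi a x) =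
    inner (cm_g a x) u v - pairing (cm_eta a x) u * pairing (cm_eta a x) v;
  cm_deta : forall a (U V : 'rV[R]_(n.*2.+1) -> 'rV[R]_(n.*2.+1)),
    smooth (img a) U -> smooth (img a) V -> forall x, img a x ->
    inner (cm_g a x) (U x) (V x *m cm_phi a x) =
    ext_deriv (cm_eta a) U V x }.

Definition sasakian (R : realType) (n : nat) (N : manifold R n.*2.+1)
    (S : contact_metric N) : Prop :=
  forall a (U V : 'rV[R]_(n.*2.+1) -> 'rV[R]_(n.*2.+1)),
    smooth (img a) U -> smooth (img a) V -> forall x, img a x ->
    (* (nabla_U phi)(V) = g(U,V) xi - eta(V) U *)
    covD (cm_g S a) U (fun y => V y *m cm_phi S a y) x
      - covD (cm_g S a) U V x *m cm_phi S a x =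
    inner (cm_g S a x) (U x) (V x) *: cm_xi S a x
      - pairing (cm_eta S a x) (V x) *: U x.

Definition constant_phi_sectional (R : realType) (n : nat)
    (N : manifold R n.*2.+1) (S : contact_metric N) (c : R) : Prop :=
  forall a x u, img a x ->
    inner (cm_g S a x) u u = 1 -> inner (cm_g S a x) u (cm_xi S a x) = 0 ->
    sectional (cm_g S a) x u (u *m cm_phi S a x) = c.

Definition sasakian_space_form (R : realType) (n : nat)
    (N : manifold R n.*2.+1) (S : contact_metric N) (c : R) : Prop :=
  sasakian S /\ constant_phi_sectional S c.

(* Local expression of psi in charts a, b, and its domain. *)
Definition local_map {R : realType} {n m : nat} (M : manifold R n)
    (N : manifold R m) (psi : M -> N) (a : chart M) (b : chart N) :
  'rV[R]_n -> 'rV[R]_m := coord N b \o psi \o point M a.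

Definition local_dom {R : realType} {n m : nat} (M : manifold R n)
    (N : manifold R m) (psi : M -> N) (a : chart M) (b : chart N) :
  set 'rV[R]_n := [set x | img a x /\ dom N b (psi (point M a x))].

Definition smooth_map {R : realType} {n m : nat} (M : manifold R n)
    (N : manifold R m) (psi : M -> N) : Prop :=
  continuous psi /\
  forall a b, smooth (local_dom psi a b) (local_map psi a b).

(* For maps from a compact manifold this Euler-Lagrange equation says that psi
   is a critical point of the bienergy. *)
Definition biharmonic {R : realType} {n m : nat} (M : manifold R n)
    (g : metric M) (N : manifold R m) (h : metric N) (psi : M -> N) : Prop :=
  forall a b x, local_dom psi a b x ->
    bitension (g a) (h b) (local_map psi a b) x = 0.

(* iota is the inclusion of a submanifold: an injective immersion.  (When M is
   compact it is automatically an embedding.) *)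
Definition submanifold {R : realType} {n m : nat} (M : manifold R n)
    (N : manifold R m) (iota : M -> N) : Prop :=
  [/\ smooth_map iota, injective iota &
      forall a b x u, local_dom iota a b x ->
        'D_u (local_map iota a b) x = 0 -> u = 0].

Definition induced_metric {R : realType} {n m : nat} (M : manifold R n)
    (g : metric M) (N : manifold R m) (h : metric N) (iota : M -> N) : Prop :=
  forall a b x u v, local_dom iota a b x ->
    inner (g a x) u v =
    inner (h b (local_map iota a b x))
      ('D_u (local_map iota a b) x) ('D_v (local_map iota a b) x).

Definition integral_submanifold {R : realType} {k n : nat} (M : manifold R k)
    (N : manifold R n.*2.+1) (S : contact_metric N) (iota : M -> N) : Prop :=
  submanifold iota /\
  forall a b x u, local_dom iota a b x ->
    pairing (cm_eta S b (local_map iota a b x))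
      ('D_u (local_map iota a b) x) = 0.

Definition minimal {R : realType} {n m : nat} (M : manifold R n)
    (g : metric M) (N : manifold R m) (h : metric N) (iota : M -> N) : Prop :=
  forall a b x, local_dom iota a b x ->
    mean_curvature (g a) (h b) (local_map iota a b) x = 0.

(* Main.v *)
(* The tension field tau = n H of an integral submanifold M of maximal dimension
   is normal to M and to the Reeb field xi.  Since df(TM), phi(df(TM)) and xi
   span the tangent space of N, phi tau is tangent to M, and the curvature of a
   Sasakian space form gives

     sum_k <R(df e_k, tau) tau, df e_k> =
       ((n + 3) c + 3 n - 3) / 4 |tau|^2 <= 0.

   On the compact M the function |tau|^2 attains its maximum at some p, so that

     sum_k (<nabla_k nabla_k tau - nabla_(nabla_k e_k) tau, tau>
            + |nabla_k tau|^2) <= 0          at p,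

   while pairing the equation tau_2 = 0 with tau shows that the first summand
   contributes - ((n + 3) c + 3 n - 3) / 4 |tau|^2 >= 0.  Hence nabla tau = 0 at
   p; differentiating <tau, df e_k> = 0 then gives |tau|^2 = 0 at p, hence
   tau = 0 everywhere.  No integration is needed.  Conversely tau = 0 trivially
   implies tau_2 = 0. *)
From HB Require Import structures.
Require Import Defs.
From mathcomp Require Import all_boot all_order all_algebra.
From mathcomp Require Import all_classical all_reals all_analysis.
From mathcomp Require Import ring lra.

Set Implicit Arguments.
Unset Strict Implicit.
Unset Printing Implicit Defensive.

Import Order.TTheory GRing.Theory Num.Theory.
Import numFieldNormedType.Exports.
Local Open Scope classical_set_scope.
Local Open Scope ring_scope.

(** * Directional derivatives and functions of class C^k *)

(** Two facts that the overview only states carry most of the work. The first is the curvature sum.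
    On the contact distribution, the curvature of the space form minus the expected model is a
    tensor of Kaehler type with zero holomorphic sectional curvature, so all its sectional values
    vanish ([curvature_vanish]). Hence <R(e, tau) tau, e> = (c + 3)/4 |tau|^2 + 3 (c - 1)/4 <e, phi
    tau>^2 for unit tangent e. As phi tau is tangent, the squares add up to |tau|^2, and n (c + 3)/4
    + 3 (c - 1)/4 is the constant of the overview; the bound on c says that it is nonpositive. That
    phi exchanges tangent and normal vectors comes from <nabla_u (df v), xi>, which is symmetric in
    u, v and also skew. The second is that |tau|^2 is a function on M at all. The tension field is
    only given by local expressions, so its norm must be shown independent of the charts on both
    sides. This rests on nabla d(theta) = 0 for a local isometry theta between spaces of equal
    dimension, applied to transition maps. Only then does compactness provide a maximum. *)

Section Derivatives.
Context {R : realType}.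
Implicit Types V W : normedModType R.

Lemma near_in {T : topologicalType} (U : set T) (x : T) :
  open U -> U x -> \forall y \near x, U y.
Proof. by move=> oU Ux; exact: open_nbhs_nbhs. Qed.

Lemma derive_eq_on V W (U : set V) (f g : V -> W) x v : open U -> U x ->
  (forall y, U y -> f y = g y) -> 'D_v f x = 'D_v g x.
Proof.
move=> oU Ux fg; apply: near_eq_derive.
by near=> y; apply: fg; near: y; exact: near_in.
Unshelve. all: by end_near. Qed.

(** The first-order expansion of [f] at [x] is also one of [g], with the same linear part;
    [diff_unique] identifies this part with the differential of [g]. *)
Lemma differentiable_near V W (f g : V -> W) x :
  (\forall y \near x, f y = g y) -> differentiable f x -> differentiable g x.
Proof.
move=> fg df; have [cf ef] := (diff_locallyP _ _).1 df.
have fgx : f x = g x by exact: (nbhs_singleton fg).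
have fg0 : \forall h \near (0:V), f (h + x) = g (h + x).
  have := fg; rewrite (near_shift 0 x (fun y => f y = g y)) => H.
  by apply: filterS H => h /=; rewrite subr0.
have eg : g \o shift x = cst (g x) + 'd f x +o_ 0 id.
  apply/eqaddoP => e e0.
  have /eqaddoP/(_ e e0) Hf := ef.
  have Hg : \forall h \near (0:V), `|f (h + x) - (f x + 'd f x h)| <= e * `|h|.
    exact: Hf.
  
  have Hg' : \forall h \near (0:V), `|g (h + x) - (g x + 'd f x h)| <= e * `|h|.
    by apply: filterS2 fg0 Hg => h -> ; rewrite fgx.
  
  exact: Hg'.

apply/diff_locallyP.

have E := diff_unique cf eg.

by rewrite E.
Qed.

Lemma differentiable_on V W (U : set V) (f g : V -> W) x : open U -> U x ->
  (forall y, U y -> f y = g y) -> differentiable f x -> differentiable g x.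
Proof.
move=> oU Ux fg; apply: differentiable_near.
by near=> y; apply: fg; near: y; exact: near_in.
Unshelve. all: by end_near. Qed.

Lemma deriveDl V W (f : V -> W) x u v : differentiable f x ->
  'D_(u + v) f x = 'D_u f x + 'D_v f x.
Proof. by move=> df; rewrite !deriveE// linearD. Qed.

Lemma deriveZl V W (f : V -> W) x a v : differentiable f x ->
  'D_(a *: v) f x = a *: 'D_v f x.
Proof. by move=> df; rewrite !deriveE// linearZ. Qed.

Lemma derive_suml V W (f : V -> W) x (I : finType) (a : I -> R) (v : I -> V) :
  differentiable f x ->
  'D_(\sum_i a i *: v i) f x = \sum_i a i *: 'D_(v i) f x.
Proof.
move=> df; rewrite deriveE// linear_sum; apply: eq_bigr => i _.
by rewrite linearZ /= -deriveE.
Qed.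

Lemma derive_comp (U V W : normedModType R) (f : U -> V) (g : V -> W) x v :
  differentiable f x -> differentiable g (f x) ->
  'D_v (fun y => g (f y)) x = 'D_('D_v f x) g (f x).
Proof.
move=> df dg.
have dgf : differentiable (g \o f) x by exact: differentiable_comp.
by rewrite (deriveE _ dgf) (deriveE _ df) (deriveE _ dg) (diff_comp df dg).
Qed.

End Derivatives.

Section Scaling.
Context {R : realType} {W : normedModType R}.

(** A named copy of scaling that can carry the bilinear structure expected by
    [differentiable_bilin]. The product rule is then the chain rule through a continuous bilinear
    map. *)
Definition scl (a : R) (w : W) : W := a *: w.

Fact scl_bilinear : bilinear_for (GRing.Scale.Law.clone _ _ *:%R _)
  (GRing.Scale.Law.clone _ _ *:%R _) scl.
Proof.
split=> [w|k] b u v /=; rewrite /scl; first by rewrite scalerDl scalerA.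
by rewrite scalerDr !scalerA mulrC.
Qed.
HB.instance Definition _ :=
  bilinear_isBilinear.Build R R W W _ _ scl scl_bilinear.

Lemma scl_continuous : continuous (fun p : R * W => scl p.1 p.2).
Proof. exact: scale_continuous. Qed.

Variables (V : normedModType R) (a : V -> R) (f : V -> W) (x : V).
Hypotheses (da : differentiable a x) (df : differentiable f x).

Lemma differentiable_scale : differentiable (fun y => a y *: f y) x.
Proof.
have dp := differentiable_pair da df.
have ds := differentiable_bilin (a x, f x) scl_continuous.
exact: (differentiable_comp dp ds).
Qed.

Lemma derive_scale v :
  'D_v (fun y => a y *: f y) x = 'D_v a x *: f x + a x *: 'D_v f x.
Proof.
have dp := differentiable_pair da df.
have ds := differentiable_bilin (a x, f x) scl_continuous.
have -> := derive_comp v dp ds.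
rewrite (deriveE _ ds) (diff_bilin _ scl_continuous) (deriveE _ dp).
by rewrite (diff_pair da df) /= -(deriveE _ da) -(deriveE _ df) addrC.
Qed.

End Scaling.

Section Sums.
Context {R : realType}.
Implicit Types V W : normedModType R.

Lemma derive_add V W (f g : V -> W) x v :
  differentiable f x -> differentiable g x ->
  'D_v (fun y => f y + g y) x = 'D_v f x + 'D_v g x.
Proof. by move=> df dg; apply: deriveD; apply: diff_derivable. Qed.

Lemma derive_opp V W (f : V -> W) x v : differentiable f x ->
  'D_v (fun y => - f y) x = - 'D_v f x.
Proof. by move=> df; apply: deriveN; apply: diff_derivable. Qed.

Lemma derive_sub V W (f g : V -> W) x v :
  differentiable f x -> differentiable g x ->
  'D_v (fun y => f y - g y) x = 'D_v f x - 'D_v g x.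
Proof. by move=> df dg; apply: deriveB; apply: diff_derivable. Qed.

Lemma differentiable_add V W (f g : V -> W) x :
  differentiable f x -> differentiable g x ->
  differentiable (fun y => f y + g y) x.
Proof. exact: differentiableD. Qed.

Lemma differentiable_bigsum V W (I : Type) (s : seq I) (h : I -> V -> W) x :
  (forall i, differentiable (h i) x) ->
  differentiable (fun y => \sum_(i <- s) h i y) x.
Proof.
move=> dh; elim: s => [|j s IHs].
  have -> : (fun y => \sum_(i <- [::]) h i y) = cst 0.
    by apply/funext => y; rewrite big_nil.
  exact: differentiable_cst.
have -> : (fun y => \sum_(i <- j :: s) h i y) =
    (fun y => h j y + \sum_(i <- s) h i y).
  by apply/funext => y; rewrite big_cons.
exact: differentiable_add.
Qed.

Lemma derive_bigsum V W (I : Type) (s : seq I) (h : I -> V -> W) x v :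
  (forall i, differentiable (h i) x) ->
  'D_v (fun y => \sum_(i <- s) h i y) x = \sum_(i <- s) 'D_v (h i) x.
Proof.
move=> dh; elim: s => [|j s IHs].
  have -> : (fun y => \sum_(i <- [::]) h i y) = cst 0.
    by apply/funext => y; rewrite big_nil.
  by rewrite derive_cst big_nil.
have -> : (fun y => \sum_(i <- j :: s) h i y) =
    (fun y => h j y + \sum_(i <- s) h i y).
  by apply/funext => y; rewrite big_cons.
rewrite derive_add ?big_cons ?IHs //; exact: differentiable_bigsum.
Qed.

Lemma differentiable_entry V p q (F : V -> 'M[R]_(p, q)) x i j :
  differentiable F x -> differentiable (fun y => F y i j) x.
Proof.
move=> dF; apply: (@differentiable_comp _ _ _ _ F (fun N => N i j)) => //.
exact: differentiable_coord.
Qed.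

Lemma derive_entry V p q (F : V -> 'M[R]_(p, q)) x v i j :
  differentiable F x -> 'D_v (fun y => F y i j) x = 'D_v F x i j.
Proof. by move=> dF; rewrite derive_mx ?mxE//; apply: diff_derivable. Qed.

End Sums.

(** * Closure properties of the class C^k *)

Section ClassCk.
Context {R : realType}.
Implicit Types V W : normedModType R.

Lemma Ck_ext V W k (U : set V) (f g : V -> W) : open U ->
  (forall y, U y -> f y = g y) -> Ck k U f -> Ck k U g.
Proof.
move=> oU; elim: k f g => [|k IHk] f g fg /=.
  move=> cf x Ux; have cfx : f @ x --> f x := cf x Ux.
  suff : g @ x --> g x by [].
  rewrite -fg//; apply: cvg_trans cfx; apply: near_eq_cvg.
  by near=> y; apply: fg; near: y; exact: near_in.
move=> [df Df]; split=> [x Ux|v];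
  first exact: (differentiable_on oU Ux fg (df x Ux)).
by apply: IHk (Df v) => y Uy; apply: derive_eq_on Uy fg.
Unshelve. all: by end_near. Qed.

Lemma CkS V W k (U : set V) (f : V -> W) : Ck k.+1 U f -> Ck k U f.
Proof.
elim: k f => [|k IHk] f [df Df].
  by move=> x Ux; apply: differentiable_continuous; apply: df.
by split=> // v; apply: IHk; apply: Df.
Qed.

Lemma Ck_cst V W k (U : set V) (w : W) : Ck k U (fun _ : V => w).
Proof.
elim: k w => [|k IHk] w /=; first by move=> x _; apply: cst_continuous.
split=> [x _|v]; first exact: differentiable_cst.
have -> : 'D_v (fun _ : V => w) = (fun=> 0) by apply/funext => x;
  exact: derive_cst.
exact: IHk.
Qed.

Lemma Ck_add V W k (U : set V) (f g : V -> W) : open U ->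
  Ck k U f -> Ck k U g -> Ck k U (fun y => f y + g y).
Proof.
move=> oU; elim: k f g => [|k IHk] f g /=.
  by move=> cf cg x Ux; apply: cvgD; [exact: cf|exact: cg].
move=> [df Df] [dg Dg]; split=> [x Ux|v].
  by apply: differentiable_add; [exact: df|exact: dg].
apply: Ck_ext (IHk _ _ (Df v) (Dg v)) => // y Uy.
by rewrite derive_add; [|exact: df|exact: dg].
Qed.

Lemma Ck_scale V W k (U : set V) (a : V -> R) (f : V -> W) : open U ->
  Ck k U a -> Ck k U f -> Ck k U (fun y => a y *: f y).
Proof.
move=> oU; elim: k a f => [|k IHk] a f.
  move=> ca cf x Ux; have := cvgZ (ca x Ux) (cf x Ux); exact.
(* The product rule leaves one factor underived, so both factors are also needed at order [k]. *)
move=> Ca Cf; have Ca' := CkS Ca; have Cf' := CkS Cf.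
case: Ca Cf => da Da [df Df]; split=> [x Ux|v].
  by apply: differentiable_scale; [exact: da|exact: df].
apply: (@Ck_ext _ _ _ _ (fun y => 'D_v a y *: f y + a y *: 'D_v f y)) => //.
  by move=> y Uy; rewrite derive_scale; [|exact: da|exact: df].
apply: Ck_add => //.
  exact: (IHk ('D_v a) f (Da v) Cf').
exact: (IHk a ('D_v f) Ca' (Df v)).
Qed.

Lemma Ck_opp V W k (U : set V) (f : V -> W) : open U ->
  Ck k U f -> Ck k U (fun y => - f y).
Proof.
move=> oU Cf; apply: (@Ck_ext _ _ _ _ (fun y => -1 *: f y)) => //.
  by move=> y _; rewrite scaleN1r.
by apply: Ck_scale => //; exact: Ck_cst.
Qed.

Lemma Ck_sub V W k (U : set V) (f g : V -> W) : open U ->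
  Ck k U f -> Ck k U g -> Ck k U (fun y => f y - g y).
Proof. by move=> oU Cf Cg; apply: Ck_add => //; exact: Ck_opp. Qed.

Lemma Ck_mul V k (U : set V) (f g : V -> R) : open U ->
  Ck k U f -> Ck k U g -> Ck k U (fun y => f y * g y).
Proof. exact: Ck_scale. Qed.

Lemma Ck_sum V W k (U : set V) (I : Type) (s : seq I) (P : pred I)
    (h : I -> V -> W) : open U ->
  (forall i, P i -> Ck k U (h i)) ->
    Ck k U (fun y => \sum_(i <- s | P i) h i y).
Proof.
move=> oU Ch; elim: s => [|j s IHs].
  apply: (@Ck_ext _ _ _ _ (fun=> 0)) => //; last exact: Ck_cst.
  by move=> y _; rewrite big_nil.
case Pj : (P j); last first.
  by apply: Ck_ext IHs => // y _; rewrite big_cons Pj.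
apply: (@Ck_ext _ _ _ _ (fun y => h j y + \sum_(i <- s | P i) h i y)) => //.
  by move=> y _; rewrite big_cons Pj.
by apply: Ck_add => //; exact: Ch.
Qed.

Lemma Ck_prod V k (U : set V) (I : Type) (s : seq I) (P : pred I)
    (h : I -> V -> R) : open U ->
  (forall i, P i -> Ck k U (h i)) ->
    Ck k U (fun y => \prod_(i <- s | P i) h i y).
Proof.
move=> oU Ch; elim: s => [|j s IHs].
  apply: (@Ck_ext V R k U (fun=> 1)) => //; last exact: Ck_cst.
  by move=> y _; rewrite big_nil.
case Pj : (P j); last first.
  by apply: Ck_ext IHs => // y _; rewrite big_cons Pj.
apply: (@Ck_ext V R k U (fun y => h j y * \prod_(i <- s | P i) h i y)) => //.
  by move=> y _; rewrite big_cons Pj.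
by apply: Ck_mul => //; exact: Ch.
Qed.

Lemma Ck_entry V k (U : set V) p q (F : V -> 'M[R]_(p, q)) i j : open U ->
  Ck k U F -> Ck k U (fun y => F y i j).
Proof.
move=> oU; elim: k F => [|k IHk] F.
  move=> cF x Ux; apply: (@continuous_comp _ _ _ F (fun N : 'M[R]_(p, q) =>
    N i j) x).
    exact: cF.
  exact: coord_continuous.
move=> [dF DF]; split=> [x Ux|v]; first exact/differentiable_entry/dF.
apply: Ck_ext (IHk _ (DF v)) => // y Uy.
by rewrite -derive_entry//; exact: dF.
Qed.

Lemma Ck_mx V k (U : set V) p q (F : V -> 'M[R]_(p, q)) : open U ->
  (forall i j, Ck k U (fun y => F y i j)) -> Ck k U F.
Proof.
move=> oU CF.
apply: (@Ck_ext _ _ _ _ (fun y => \sum_i \sum_j F y i j *: delta_mx i j)) => //.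
  by move=> y _; rewrite -matrix_sum_delta.
apply: Ck_sum => // i _; apply: Ck_sum => // j _; apply: Ck_scale => //.
exact: Ck_cst.
Qed.

(** The derivative of the inverse is a polynomial in the inverse itself and the derivative of [a],
    so the induction on [k] keeps [a] fixed. *)
Lemma Ck_inv V k (U : set V) (a : V -> R) : open U ->
  (forall y, U y -> a y != 0) -> Ck k U a -> Ck k U (fun y => (a y)^-1).
Proof.
move=> oU a0; elim: k => [|k IHk].
  by move=> ca x Ux; apply: cvgV; [exact: a0|exact: ca].
move=> Ca; have Ca' := CkS Ca; case: Ca => da Da; split=> [x Ux|v].
  by apply: differentiableV; [exact: da|exact: a0].
apply: (@Ck_ext V R k U (fun y => - ((a y)^-1 * (a y)^-1 * 'D_v a y))) => //.
  move=> y Uy; rewrite (@deriveV _ _ a y v) ?a0//; last first.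
    by apply: diff_derivable; apply: da.
  by rewrite -exprVn expr2 scaleNr.
apply: Ck_opp => //; apply: Ck_mul => //; last exact: Da.
by apply: Ck_mul => //; exact: IHk.
Qed.

End ClassCk.

Section Ck_matrices.
Context {R : realType}.
Implicit Types V W : normedModType R.

Lemma derive_basis W m (g : 'rV[R]_m -> W) y v : differentiable g y ->
  'D_v g y = \sum_i v 0 i *: 'D_(basis_vec i) g y.
Proof. by move=> dg; rewrite {1}[v]row_sum_delta derive_suml. Qed.

(** In the chain rule the direction ['D_v f y] varies with [y], whereas [Ck] controls derivatives in
    fixed directions; expanding along the basis reconciles the two. *)
Lemma Ck_comp V W m k (U : set V) (U' : set 'rV[R]_m) (f : V -> 'rV[R]_m)
    (g : 'rV[R]_m -> W) : open U -> (forall y, U y -> U' (f y)) ->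
  Ck k U f -> Ck k U' g -> Ck k U (fun y => g (f y)).
Proof.
move=> oU fU; elim: k f g fU => [|k IHk] f g fU.
  move=> cf cg x Ux; apply: (@continuous_comp _ _ _ f g x).
    exact: cf.
  by apply: cg; apply: fU.
move=> Cf; have Cf' := CkS Cf; case: Cf => df Df [dg Dg].
split=> [x Ux|v].
  by apply: (@differentiable_comp _ _ _ _ f g); [exact: df|apply: dg;
    exact: fU].
apply: (@Ck_ext _ V W k U
    (fun y => \sum_i ('D_v f y) 0 i *: 'D_(basis_vec i) g (f y))) => //.
  move=> y Uy; rewrite (derive_comp _ (df y Uy) (dg _ (fU y Uy))).
  by rewrite -derive_basis//; apply: dg; exact: fU.
apply: Ck_sum => // i _; apply: Ck_scale => //.
  by apply: Ck_entry => //; exact: Df.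
exact: (IHk f ('D_(basis_vec i) g) fU Cf' (Dg _)).
Qed.

Lemma Ck_det V k (U : set V) n (A : V -> 'M[R]_n) : open U ->
  Ck k U A -> Ck k U (fun y => \det (A y)).
Proof.
move=> oU CA; apply: Ck_sum => // s _; apply: Ck_mul => //.
  exact: Ck_cst.
by apply: Ck_prod => // i _; exact: Ck_entry.
Qed.

(** Cramer's rule leaves only polynomials in the entries and one scalar inverse. *)
Lemma Ck_invmx V k (U : set V) n (A : V -> 'M[R]_n) : open U ->
  (forall y, U y -> A y \in unitmx) ->
  Ck k U A -> Ck k U (fun y => invmx (A y)).
Proof.
move=> oU Au CA.
apply: (@Ck_ext _ _ _ _ _ (fun y => (\det (A y))^-1 *: \adj (A y))) => //.
  by move=> y Uy; rewrite /invmx Au.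
apply: Ck_scale => //.
  apply: Ck_inv => //; last exact: Ck_det.
  by move=> y /Au; rewrite unitmxE unitfE.
apply: Ck_mx => // i j.
apply: (@Ck_ext _ V R k U
    (fun y => (-1) ^+ (j + i) * \det (row' j (col' i (A y))))) => //.
  by move=> y _; rewrite mxE.
apply: Ck_mul => //; first exact: Ck_cst.
apply: Ck_det => //; apply: Ck_mx => // i' j'.
apply: (@Ck_ext _ V R k U (fun y => A y (lift j i') (lift i j'))) => //.
  by move=> y _; rewrite !mxE.
exact: Ck_entry.
Qed.

End Ck_matrices.

(** * Bilinear maps depending on a point *)

Section BilinearFamilies.
Context {R : realType}.
Implicit Types V W : normedModType R.

(** A plain proposition rather than a canonical structure: the maps met later depend on a point, and
    some, like [nab G H f x], are shown bilinear only for points of a domain. *)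
Definition bil p q (W : lmodType R) (b : 'rV[R]_p -> 'rV[R]_q -> W) : Prop :=
  (forall a u u' w, b (a *: u + u') w = a *: b u w + b u' w) /\
  (forall a u w w', b u (a *: w + w') = a *: b u w + b u w').

Section BilTheory.
Variables (p q : nat) (W : lmodType R) (b : 'rV[R]_p -> 'rV[R]_q -> W).
Hypothesis bb : bil b.

Lemma bilDl u u' w : b (u + u') w = b u w + b u' w.
Proof. by have := bb.1 1 u u' w; rewrite !scale1r. Qed.
Lemma bilDr u w w' : b u (w + w') = b u w + b u w'.
Proof. by have := bb.2 1 u w w'; rewrite !scale1r. Qed.
Lemma bil0l w : b 0 w = 0.
Proof. by apply: (addrI (b 0 w)); rewrite -bilDl !addr0. Qed.
Lemma bil0r u : b u 0 = 0.
Proof. by apply: (addrI (b u 0)); rewrite -bilDr !addr0. Qed.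
Lemma bilZl a u w : b (a *: u) w = a *: b u w.
Proof. by have := bb.1 a u 0 w; rewrite bil0l !addr0. Qed.
Lemma bilZr a u w : b u (a *: w) = a *: b u w.
Proof. by have := bb.2 a u w 0; rewrite bil0r !addr0. Qed.
Lemma bilNl u w : b (- u) w = - b u w.
Proof. by rewrite -(scaleN1r u) bilZl scaleN1r. Qed.
Lemma bilNr u w : b u (- w) = - b u w.
Proof. by rewrite -(scaleN1r w) bilZr scaleN1r. Qed.
Lemma bilBl u u' w : b (u - u') w = b u w - b u' w.
Proof. by rewrite bilDl bilNl. Qed.
Lemma bilBr u w w' : b u (w - w') = b u w - b u w'.
Proof. by rewrite bilDr bilNr. Qed.
Lemma bil_suml I (s : seq I) (u : I -> 'rV[R]_p) w :
  b (\sum_(i <- s) u i) w = \sum_(i <- s) b (u i) w.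
Proof.
by elim: s => [|i s IHs]; rewrite ?big_nil ?bil0l// !big_cons bilDl IHs.
Qed.
Lemma bil_sumr I (s : seq I) u (w : I -> 'rV[R]_q) :
  b u (\sum_(i <- s) w i) = \sum_(i <- s) b u (w i).
Proof.
by elim: s => [|i s IHs]; rewrite ?big_nil ?bil0r// !big_cons bilDr IHs.
Qed.

Lemma bil_expand u w :
  b u w = \sum_i \sum_j (u 0 i * w 0 j) *: b (basis_vec i) (basis_vec j).
Proof.
rewrite {1}[u]row_sum_delta bil_suml; apply: eq_bigr => i _ /=.
rewrite bilZl {1}[w]row_sum_delta bil_sumr scaler_sumr;
  apply: eq_bigr => j _ /=.
by rewrite bilZr scalerA.
Qed.

End BilTheory.

Section DeriveBil.
Variables (V W : normedModType R) (p q : nat).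
Variables (b : V -> 'rV[R]_p -> 'rV[R]_q -> W) (U : set V).
Hypothesis bb : forall y, bil (b y).

Lemma Ck_bil k X Y : open U -> (forall u w, Ck k U (fun y => b y u w)) ->
  Ck k U X -> Ck k U Y -> Ck k U (fun y => b y (X y) (Y y)).
Proof.
move=> oU Cb CX CY.
apply: (@Ck_ext _ V W k U (fun y => \sum_i \sum_j (X y 0 i * Y y 0 j) *:
  b y (basis_vec i) (basis_vec j))) => //.
  by move=> y _; rewrite -bil_expand.
apply: Ck_sum => // i _; apply: Ck_sum => // j _; apply: Ck_scale => //.
by apply: Ck_mul => //; exact: Ck_entry.
Qed.

Variables (X : V -> 'rV[R]_p) (Y : V -> 'rV[R]_q) (x : V).
Hypotheses (db : forall u w, differentiable (fun y => b y u w) x).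
Hypotheses (dX : differentiable X x) (dY : differentiable Y x).

Let expanded := fun y => \sum_i \sum_j (X y 0 i * Y y 0 j) *:
  b y (basis_vec i) (basis_vec j).

Let expandedE : (fun y => b y (X y) (Y y)) = expanded.
Proof. by apply/funext => y; rewrite (bil_expand (bb y)). Qed.

Let dXY i j : differentiable (fun y => X y 0 i * Y y 0 j : R) x.
Proof.
by apply: (@differentiable_scale _ R); exact: differentiable_entry.
Qed.

Lemma differentiable_bilfam : differentiable (fun y => b y (X y) (Y y)) x.
Proof.
rewrite expandedE; apply: differentiable_bigsum => i.
apply: differentiable_bigsum => j; exact: differentiable_scale.
Qed.

(** Leibniz rule with a third term for the variation of [b] itself. Differentiability of [b] is only
    asked with constant arguments, which suffices after expanding along the bases. *)
Lemma derive_bilfam v : 'D_v (fun y => b y (X y) (Y y)) x =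
  'D_v (fun y => b y (X x) (Y x)) x + b x ('D_v X x) (Y x) +
    b x (X x) ('D_v Y x).
Proof.
have -> : (fun y => b y (X x) (Y x)) = (fun y =>
    \sum_i \sum_j (X x 0 i * Y x 0 j) *: b y (basis_vec i) (basis_vec j)).
  by apply/funext => y; rewrite (bil_expand (bb y)).
rewrite expandedE !(bil_expand (bb x) _ _).
rewrite !derive_bigsum; first last.
- move=> i; apply: differentiable_bigsum => j.
  exact: differentiable_scale.
- move=> i; apply: differentiable_bigsum => j.
  by apply: differentiable_scale => //; exact: differentiable_cst.
rewrite -!big_split; apply: eq_bigr => i _ /=.
rewrite !derive_bigsum; first last.
- by move=> j; exact: differentiable_scale.
- by move=> j; apply: differentiable_scale => //; exact: differentiable_cst.
rewrite -!big_split; apply: eq_bigr => j _ /=.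
rewrite derive_scale//.
rewrite (derive_scale (differentiable_cst _ _) (db _ _)) derive_cst.
rewrite scale0r add0r [LHS]addrC -addrA; congr (_ + _).
rewrite -scalerDl; congr (_ *: _).
rewrite (@derive_scale R R) ?derive_entry//; exact: differentiable_entry.
Qed.

End DeriveBil.

End BilinearFamilies.

(** * Symmetry of second derivatives, second derivative test *)

Section SecondDerivatives.
Context {R : realType}.
Implicit Types V : normedModType R.

Lemma near_segment V (P : V -> Prop) x u v : (\forall y \near x, P y) ->
  exists2 t : R, 0 < t & forall s r : R, 0 <= s <= t -> 0 <= r <= t ->
    P (x + s *: u + r *: v).
Proof.
move=> /nbhs_ballP[e /= e0 Pe].
(* The summand 1 keeps the denominator positive when [u] and [v] are both zero. *)
have D0 : 0 < `|u| + `|v| + 1 by rewrite ltr_pwDr// addr_ge0.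
exists (e / (`|u| + `|v| + 1) / 2); first by rewrite !divr_gt0.
move=> s r /andP[s0 st] /andP[r0 rt]; apply: Pe.
rewrite -ball_normE /ball_ /= -addrA opprD addrA subrr sub0r normrN.
set t := e / _ / 2 in st rt.
have t0 : 0 < t by rewrite !divr_gt0.
apply: (@le_lt_trans _ _ (t * (`|u| + `|v|))).
  rewrite (le_trans (ler_normD _ _))// !normrZ !ger0_norm// mulrDr.
  by rewrite lerD// ler_wpM2r.
have tE : t * 2 * (`|u| + `|v| + 1) = e.
  by rewrite /t divfK// divfK// gt_eqF.
rewrite -[X in _ < X]tE -mulrA ltr_pM2l//.
have := addr_ge0 (normr_ge0 u) (normr_ge0 v); lra.
Qed.

Lemma near_dist V (g : V -> R) x e : {for x, continuous g} -> 0 < e ->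
  \forall y \near x, `|g x - g y| < e.
Proof. by move=> /cvgrPdist_lt; apply. Qed.

Lemma near_gt0 V (g : V -> R) x : {for x, continuous g} -> 0 < g x ->
  \forall y \near x, 0 < g y.
Proof. by move=> cg g0; exact: (cvgr_gt _ cg _ g0). Qed.

Lemma near_and V (P Q : V -> Prop) (x : V) : (\forall y \near x, P y) ->
  (\forall y \near x, Q y) -> \forall y \near x, P y /\ Q y.
Proof. by move=> hP hQ; apply: filterS2 hP hQ => y Py Qy; split. Qed.

Lemma near_and3 V (P Q S : V -> Prop) (x : V) : (\forall y \near x, P y) ->
  (\forall y \near x, Q y) -> (\forall y \near x, S y) ->
  \forall y \near x, [/\ P y, Q y & S y].
Proof. by move=> hP hQ hS; apply: filterS3 hP hQ hS => y Py Qy Sy; split. Qed.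

Lemma is_derive_line V (F : V -> R) x u s : differentiable F (x + s *: u) ->
  is_derive s 1 (fun r : R => F (x + r *: u)) ('D_u F (x + s *: u)).
Proof.
move=> dF.
have dl : differentiable (fun r : R => x + r *: u) s.
  apply: differentiable_add; first exact: differentiable_cst.
  by apply: differentiable_scale; [exact: (@ex_diff _ _ _ _ _ id id)|
    exact: differentiable_cst].
have Dl : 'D_1 (fun r : R => x + r *: u) s = u.
  rewrite derive_add; [|exact: differentiable_cst|]; last first.
    by apply: differentiable_scale; [exact: (@ex_diff _ _ _ _ _ id id)|
      exact: differentiable_cst].
  rewrite derive_cst add0r derive_scale; last first.
  - exact: differentiable_cst.
  - exact: (@ex_diff _ _ _ _ _ id id).
  by rewrite derive_cst scaler0 addr0 derive_id scale1r.
apply: DeriveDef; last by rewrite (derive_comp (1 : R) dl dF) Dl.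
by apply: diff_derivable; exact: (differentiable_comp dl dF).
Qed.

Lemma MVT_line V (F : V -> R) x u (t : R) : 0 < t ->
  (forall s : R, 0 <= s <= t -> differentiable F (x + s *: u)) ->
  exists2 s, 0 < s < t & F (x + t *: u) - F x = t * 'D_u F (x + s *: u).
Proof.
move=> t0 dF.
have [s|/=|s] := @MVT R (fun r => F (x + r *: u))
  (fun r => 'D_u F (x + r *: u)) 0 t t0.
- rewrite in_itv /= => /andP[s0 st]; apply: is_derive_line; apply: dF.
  by rewrite !ltW.
- apply: derivable_within_continuous => s; rewrite in_itv /= => st.
  by have [] := is_derive_line (dF s st).
- rewrite in_itv /= => st; rewrite scale0r addr0 subr0 mulrC => E.
  by exists s.
Qed.

(** The mean value theorem twice: along [u] for the increment of [F] by [t *: v], then along [v] for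
    ['D_u F]. The left-hand side is symmetric in [u] and [v], which is the point. *)
Lemma second_difference V (F : V -> R) x u v (t : R) : 0 < t ->
  (forall s r : R, 0 <= s <= t -> 0 <= r <= t ->
    differentiable F (x + s *: u + r *: v) /\
    differentiable ('D_u F) (x + s *: u + r *: v)) ->
  exists s r, [/\ 0 <= s <= t, 0 <= r <= t &
    F (x + t *: u + t *: v) - F (x + t *: u) - (F (x + t *: v) - F x) =
    t * (t * 'D_v ('D_u F) (x + s *: u + r *: v))].
Proof.
move=> t0 dF.
have t01 : 0 <= t <= t by rewrite lexx ltW.
have z01 : (0 : R) <= 0 <= t by rewrite lexx ltW.
have dsh s : 0 <= s <= t ->
  differentiable (fun y => F (y + t *: v)) (x + s *: u).
  move=> st; apply: (@differentiable_comp _ _ _ _ (fun y => y + t *: v) F).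
    by apply: differentiable_add => //; exact: differentiable_cst.
  by have [] := dF s t st t01.
have d0 s : 0 <= s <= t -> differentiable F (x + s *: u).
  by move=> st; have [+ _] := dF s 0 st z01; rewrite scale0r addr0.
have [s|s /andP[s0 st]] := @MVT_line V (fun y => F (y + t *: v) - F y) x u t t0.
  by move=> st; apply: differentiableB; [exact: dsh|exact: d0].
have s01 : 0 <= s <= t by rewrite !ltW.
rewrite derive_sub; [|exact: dsh|exact: d0].
have -> : 'D_u (fun y => F (y + t *: v)) (x + s *: u) =
    'D_u F (x + s *: u + t *: v).
  have dy : differentiable (fun y : V => y + t *: v) (x + s *: u).
    by apply: differentiable_add => //; exact: differentiable_cst.
  rewrite (@derive_comp _ _ _ _ (fun y => y + t *: v) F)//; last first.
    by have [] := dF s t s01 t01.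
  rewrite derive_add//.
  by rewrite derive_cst addr0 derive_id.
have [r|r /andP[r0 rt]] := @MVT_line V ('D_u F) (x + s *: u) v t t0.
  by move=> rt; have [] := dF s r s01 rt.
by move=> -> E; exists s, r; split => //; rewrite !ltW.
Qed.

(** If the mixed derivatives differed by [e] at [x], a small parallelogram would keep each within
    [e / 2] of its value at [x]; yet the symmetric second difference forces them to agree at two
    points of it. *)
Lemma schwarz V (U : set V) (F : V -> R) x u v : open U -> U x -> Ck 2 U F ->
  'D_u ('D_v F) x = 'D_v ('D_u F) x.
Proof.
move=> oU Ux [dF DF].
have [[dFu DFu] [dFv DFv]] := (DF u, DF v).
apply/eqP; rewrite -subr_eq0 -normr_le0 leNgt; apply/negP => e0.
have [e eE] : exists e, e = `|'D_u ('D_v F) x - 'D_v ('D_u F) x| by eexists.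
rewrite -eE in e0; have e20 : 0 < e / 2 by rewrite divr_gt0.
have := @near_segment V (fun y => [/\ U y,
  `|'D_u ('D_v F) x - 'D_u ('D_v F) y| < e / 2 &
  `|'D_v ('D_u F) x - 'D_v ('D_u F) y| < e / 2]) x u v.
case.
  have c1 := near_dist (DFu v x Ux) e20.
  have c2 := near_dist (DFv u x Ux) e20.
  exact: near_and3 (near_in oU Ux) c2 c1.
move=> t t0 H.
have [s r st rt|s [r [st rt E1]]] := @second_difference V F x u v t t0.
  by have [Uy _ _] := H s r st rt; split; [exact: dF|exact: dFu].
have [s' r' st' rt'|s' [r' [st' rt' E2]]] := @second_difference V F x v u t t0.
  have [+ _ _] := H r' s' rt' st'; rewrite addrAC => Uy.
  by split; [exact: dF|exact: dFv].
have E : 'D_v ('D_u F) (x + s *: u + r *: v) =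
    'D_u ('D_v F) (x + s' *: v + r' *: u).
  apply: (mulfI (lt0r_neq0 t0)); apply: (mulfI (lt0r_neq0 t0)).
  have swap (a b c d : R) : a - b - (c - d) = a - c - (b - d) by ring.
  have xuv : x + t *: v + t *: u = x + t *: u + t *: v by exact: addrAC.
  rewrite xuv in E2; exact: etrans (esym E1) (etrans (swap _ _ _ _) E2).
have [_ _ A1] := H s r st rt.
have := H r' s' rt' st'; rewrite addrAC => -[_ A2 _].
suff : e < e by rewrite ltxx.
rewrite [X in _ < X]splitr {1}eE.
rewrite E distrC in A1.
rewrite -(subrKA ('D_u ('D_v F) (x + s' *: v + r' *: u))).
exact: le_lt_trans (ler_normD _ _) (ltrD A2 A1).
Qed.

Lemma schwarz_mx V (U : set V) p q (F : V -> 'M[R]_(p, q)) x u v : open U ->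
  U x -> Ck 2 U F -> 'D_u ('D_v F) x = 'D_v ('D_u F) x.
Proof.
move=> oU Ux CF; have [dF DF] := CF; apply/matrixP => i j.
have DE w z : 'D_w ('D_z F) x i j = 'D_w ('D_z (fun y => F y i j)) x.
  rewrite -derive_entry; last by have [+ _] := DF z; apply.
  apply: derive_eq_on Ux _ => // y Uy.
  by rewrite derive_entry//; exact: dF.
have S := schwarz u v oU Ux (Ck_entry i j oU CF).
exact: etrans (DE u v) (etrans S (esym (DE v u))).
Qed.

Lemma derive_at_max V (U : set V) (F : V -> R) x u : open U -> U x ->
  Ck 1 U F -> (forall y, U y -> F y <= F x) -> 'D_u F x = 0.
Proof.
move=> oU Ux [dF DF] Fmax.
(* Applied to both [u] and [- u]. *)
suff le0 w : 'D_w F x <= 0.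
  apply/eqP; rewrite eq_le le0 /= -oppr_le0.
  have -> : - 'D_u F x = 'D_(- u) F x.
    by rewrite -(scaleN1r u) deriveZl ?scaleN1r//; exact: dF.
  exact: le0.
rewrite leNgt; apply/negP => D0.
have := @near_segment V (fun y => U y /\ 0 < 'D_w F y) x w 0.
case.
  have c1 := near_gt0 (DF w x Ux) D0.
  exact: near_and (near_in oU Ux) c1.
move=> t t0 H.
have H' s : 0 <= s <= t -> U (x + s *: w) /\ 0 < 'D_w F (x + s *: w).
  move=> st; have := H s 0 st; rewrite scale0r addr0; apply.
  by rewrite lexx ltW.
have [s st|s /andP[s0 st] E] := @MVT_line V F x w t t0.
  by have [Uy _] := H' s st; exact: dF.
have [_ Ds] := H' s ltac:(by rewrite !ltW).
have [Ut _] := H' t ltac:(by rewrite lexx ltW).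
have := Fmax _ Ut; rewrite -subr_le0 E leNgt => /negP; apply.
exact: mulr_gt0.
Qed.

(** The first derivative is zero at [x]. A positive second derivative would make it positive on a
    short segment from [x], and [F] would exceed its maximum there. *)
Lemma derive2_at_max V (U : set V) (F : V -> R) x u : open U -> U x ->
  Ck 2 U F -> (forall y, U y -> F y <= F x) -> 'D_u ('D_u F) x <= 0.
Proof.
move=> oU Ux CF Fmax; have D1 := derive_at_max u oU Ux (CkS CF) Fmax.
have [dF DF] := CF; have [dFu DFu] := DF u.
rewrite leNgt; apply/negP => D0.
have := @near_segment V (fun y => U y /\ 0 < 'D_u ('D_u F) y) x u 0.
case.
  have c1 := near_gt0 (DFu u x Ux) D0.
  exact: near_and (near_in oU Ux) c1.
move=> t t0 H.
have H' s : 0 <= s <= t -> U (x + s *: u) /\ 0 < 'D_u ('D_u F) (x + s *: u).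
  move=> st; have := H s 0 st; rewrite scale0r addr0; apply.
  by rewrite lexx ltW.
have [s st|s /andP[s0 st] E] := @MVT_line V F x u t t0.
  by have [Uy _] := H' s st; exact: dF.
have [r /andP[r0 rs]|r /andP[r0 rs] E'] := @MVT_line V ('D_u F) x u s s0.
  have [|Uy _] := H' r; last exact: dFu.
  by rewrite r0 (le_trans rs)// ltW.
have [_ Dr] := H' r ltac:(by rewrite ltW//= ltW// (lt_trans rs)).
have [Ut _] := H' t ltac:(by rewrite lexx ltW).
have := Fmax _ Ut; rewrite -subr_le0 E leNgt => /negP; apply.
rewrite mulr_gt0//; move: E'; rewrite D1 subr0 => ->.
exact: mulr_gt0.
Qed.

End SecondDerivatives.

(** * Algebraic curvature tensors *)

Section KaehlerCurvature.
Variables (R : realFieldType) (V : lmodType R).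
Variables (T : V -> V -> V -> V -> R) (J : V -> V).
Hypothesis TD : forall x x' y z w, T (x + x') y z w = T x y z w + T x' y z w.
Hypothesis TN : forall x y z w, T (- x) y z w = - T x y z w.
Hypothesis T12 : forall x y z w, T x y z w = - T y x z w.
Hypothesis T34 : forall x y z w, T x y z w = - T x y w z.
Hypothesis Tbianchi : forall x y z w, T x y z w + T y z x w + T z x y w = 0.
Hypothesis JD : forall x y, J (x + y) = J x + J y.
Hypothesis JN : forall x, J (- x) = - J x.
Hypothesis TJ : forall x y z w, T x y (J z) (J w) = T x y z w.
Hypothesis TJJ : forall x y z w, T (J (J x)) y z w = - T x y z w.
Hypothesis T0 : forall x, T x (J x) (J x) x = 0.

(** A linear combination of the four Bianchi identities obtained by rotating the arguments. *)
Lemma curvature_pair_sym x y z w : T x y z w = T z w x y.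
Proof.
have := Tbianchi x y z w; have := Tbianchi y z w x.
have := Tbianchi z w x y; have := Tbianchi w x y z.
rewrite (T12 z x) (T34 y z w) (T34 z w y) (T12 w y) (T34 y w z).
rewrite (T12 w x z) (T34 x w z) (T34 x z w) (T12 w x y) (T34 x y w).
lra.
Qed.

(** Polarize [T0] at x + y and x - y. The Kaehler identities reduce the six mixed terms to K =
    T(x,y,y,x) and L = T(x,Jy,Jy,x), and the result reads 2 K + 6 L = 0. *)
Lemma curvature_quarter x y : T x y y x = - 3 * T x (J y) (J y) x.
Proof.
have sym := curvature_pair_sym.
have TD4 a b c d d' : T a b c (d + d') = T a b c d + T a b c d'.
  by rewrite (T34 a b) (sym a b) TD (T34 a b c d)
    (T34 a b c d') !(sym a b) opprD.
have TD3 a b c d d' : T a b (d + d') c = T a b d c + T a b d' c.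
  by rewrite (T34 a b) TD4 (T34 a b d) (T34 a b d') opprD.
have TD2 a b b' c d : T a (b + b') c d = T a b c d + T a b' c d.
  by rewrite (T12 a) TD (T12 a b) (T12 a b') opprD.
have TN4 a b c d : T a b c (- d) = - T a b c d.
  by rewrite (T34 a b) (sym a b) TN (T34 a b c d) (sym a b).
have TN3 a b c d : T a b (- c) d = - T a b c d.
  by rewrite (T34 a b) TN4 (T34 a b c d).
have TN2 a b c d : T a (- b) c d = - T a b c d.
  by rewrite (T12 a) TN (T12 a b).
have TJ12 a b c d : T (J a) (J b) c d = T a b c d by rewrite sym TJ sym.
have TJJ3 a b c d : T a b (J (J c)) d = - T a b c d by rewrite sym TJJ sym.
have TJ34 a b c d : T a b (J c) d = - T a b c (J d) by rewrite -TJ TJJ3.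
(* The part of [T z (J z) (J z) z] that is quadratic in both [x] and [y],
   for [z = x + y], vanishes. *)
have P : T y (J y) (J x) x + T y (J x) (J y) x + T y (J x) (J x) y +
    T x (J y) (J y) x + T x (J y) (J x) y + T x (J x) (J y) y = 0.
  have := T0 (x + y); have := T0 (x + - y); have := T0 x; have := T0 y.
  rewrite !JD JN !TD !TD2 !TD3 !TD4 !(TN, TN2, TN3, TN4); lra.
have flip a b : T a b b a = T b a a b by rewrite (T12 a) (T34 b) opprK.
have e1 a b : T a (J b) (J b) a = T b (J a) (J a) b.
  rewrite -(TJ12 a) (T12 (J a)) TJJ TJ34 T12 !opprK; exact: flip.
have e2 a b : T a (J b) (J a) b = T a (J b) (J b) a by rewrite TJ34 T34 opprK.
have e3 a b : T a (J a) (J b) b = T a b b a + T a (J b) (J b) a.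
  have := Tbianchi a (J a) (J b) b.
  by rewrite TJ12 (T34 a b a) (TJ34 (J b)) (flip (J b)); lra.
move: P; rewrite !e3 !e2 (e1 y x) (flip y x); lra.
Qed.

(** Applying [curvature_quarter] to y and then to J y multiplies the value by 9. Only [TJJ], not J J
    = - 1, is used, since the [J] of the application, [phi], has the Reeb vector in its kernel. *)
Lemma curvature_vanish x y : T x y y x = 0.
Proof.
have sym := curvature_pair_sym.
have TJJ3 a b c d : T a b (J (J c)) d = - T a b c d by rewrite sym TJJ sym.
have TJJ2 a b c d : T a (J (J b)) c d = - T a b c d.
  by rewrite (T12 a) TJJ (T12 a b).
by have := curvature_quarter x y; have := curvature_quarter x (J y);
  rewrite TJJ2 TJJ3; lra.
Qed.

End KaehlerCurvature.

(* [g], [J] and [xi] stand for the metric, [phi] and the Reeb vector at a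
   point, [Q] for the lowered curvature tensor. *)
Section SasakianCurvature.
Variables (R : realFieldType) (V : lmodType R).
Variables (g : V -> V -> R) (J : V -> V) (xi : V).
Variables (Q : V -> V -> V -> V -> R) (c : R).
Hypothesis gD : forall x y z, g (x + y) z = g x z + g y z.
Hypothesis gZ : forall a x z, g (a *: x) z = a * g x z.
Hypothesis gsym : forall x y, g x y = g y x.
Hypothesis JD : forall x y, J (x + y) = J x + J y.
Hypothesis JN : forall x, J (- x) = - J x.
Hypothesis Jxi : J xi = 0.
Hypothesis gJ : forall x y, g x (J y) = - g (J x) y.
Hypothesis JJ : forall x, g x xi = 0 -> J (J x) = - x.
Hypothesis QD : forall x x' y z w, Q (x + x') y z w = Q x y z w + Q x' y z w.
Hypothesis QZ : forall a x y z w, Q (a *: x) y z w = a * Q x y z w.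
Hypothesis Q12 : forall x y z w, Q x y z w = - Q y x z w.
Hypothesis Q34 : forall x y z w, Q x y z w = - Q x y w z.
Hypothesis Qbianchi : forall x y z w, Q x y z w + Q y z x w + Q z x y w = 0.
Hypothesis QJ : forall x y z w, g w xi = 0 ->
  Q x y (J z) (J w) = Q x y z w - g y z * g x w + g x z * g y w
                      + g z (J x) * g y (J w) - g z (J y) * g x (J w).
Hypothesis Qc : forall u, g u xi = 0 -> Q u (J u) (J u) u = c * g u u ^+ 2.

(** The difference between [Q] and the model is made into a Kaehler-type tensor [T], to which
    [curvature_vanish] applies; the formula is then read off from the model. *)
Lemma sasakian_curvature x h : g x xi = 0 -> g h xi = 0 -> g x h = 0 ->
  Q x h h x = (c + 3) / 4 * (g x x * g h h) + 3 * (c - 1) / 4 * g x (J h) ^+ 2.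
Proof.
have gN u v : g (- u) v = - g u v by rewrite -scaleN1r gZ mulN1r.
have gDr u v w : g u (v + w) = g u v + g u w by rewrite !(gsym u) gD.
have gNr u v : g u (- v) = - g u v by rewrite !(gsym u) gN.
have QN x1 y z w : Q (- x1) y z w = - Q x1 y z w by rewrite -scaleN1r QZ mulN1r.
have hJ u : g (J u) xi = 0.
  by rewrite -[LHS]opprK -gJ Jxi -[0](subrr xi) gDr gNr subrr oppr0.
have JJJ u : J (J (J u)) = - J u by exact: JJ.
(* [a] and [b] are the metric and the fundamental form, pulled back by [J]. Hiding them behind
   existentials makes them opaque, so that the rewriting rules below keep their shape. *)
have [a aE] : exists a, forall u v, a u v = g (J u) (J v).
  by exists (fun u v => g (J u) (J v)).
have [b bE] : exists b, forall u v, b u v = g (J u) (J (J v)).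
  by exists (fun u v => g (J u) (J (J v))).
have aS u v : a u v = a v u by rewrite !aE gsym.
have bS u v : b u v = - b v u by rewrite !bE gJ gsym.
have b0 u : b u u = 0 by have := bS u u; lra.
have aJr u v : a u (J v) = b u v by rewrite aE bE.
have aJl u v : a (J u) v = - b u v by rewrite bE gJ opprK aE.
have bJr u v : b u (J v) = - a u v by rewrite aE bE JJJ gNr.
have bJl u v : b (J u) v = a u v by rewrite aE bE -[LHS]opprK -gJ JJJ gNr opprK.
have aD u u' v : a (u + u') v = a u v + a u' v by rewrite !aE JD gD.
have aN u v : a (- u) v = - a u v by rewrite !aE JN gN.
have aDr u v v' : a u (v + v') = a u v + a u v' by rewrite !aE JD gDr.
have aNr u v : a u (- v) = - a u v by rewrite !aE JN gNr.
have bD u u' v : b (u + u') v = b u v + b u' v by rewrite !bE JD gD.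
have bN u v : b (- u) v = - b u v by rewrite !bE JN gN.
have bDr u v v' : b u (v + v') = b u v + b u v' by rewrite !bE !JD gDr.
have bNr u v : b u (- v) = - b u v by rewrite !bE !JN gNr.
(* [Q] minus the curvature of the space form, both restricted to the contact
   distribution by precomposing with [J]. *)
pose T x y z w := Q (J x) (J y) (J z) (J w) -
  ((c + 3) / 4 * (a z y * a x w - a z x * a y w) +
   (c - 1) / 4 * (b z x * b y w - b z y * b x w - 2 * b x y * b z w)).
have T0 : forall u v, T u v v u = 0.
  apply: (@curvature_vanish _ _ T J) => //; rewrite /T.
  - by move=> *; rewrite !JD QD !(aD, bD, aDr, bDr); ring.
  - by move=> *; rewrite !JN QN !(aN, bN, aNr, bNr); ring.
  - by move=> x' y z w; rewrite Q12 (bS y x'); ring.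
  - move=> x' y z w; rewrite Q34 (aS w y) (aS w x') (aS x' z) (aS y z).
    by rewrite (bS w x') (bS w y) (bS y z) (bS x' z) (bS w z); ring.
  - move=> x' y z w; have := Qbianchi (J x') (J y) (J z) (J w).
    rewrite (aS y x') (aS z x') (aS z y) (bS y x') (bS z x') (bS z y).
    by move=> E; rewrite -[RHS]E; ring.
  (* The coefficients (c + 3)/4 and (c - 1)/4 differ by 1, so the failure of the model to be
     [J]-invariant equals the correction in [QJ]. *)
  - move=> x' y z w; rewrite QJ ?hJ// -!(aE, bE) !(aJl, aJr, bJl, bJr).
    by rewrite (aS y z) (aS x' z); field.
  - by move=> *; rewrite JJJ QN !(aJl, aJr, bJl, bJr); ring.
  - by move=> u; rewrite Qc// -!aE !(aJl, aJr, bJl, bJr) !b0; field.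
move=> gx gh gxh; have JJx := JJ gx; have JJh := JJ gh.
(* [T] precomposes with [J], and [J] squares to - 1 on [x] and [h]: evaluating at [J x] and [J h]
   recovers [Q x h h x]. *)
have := T0 (J x) (J h); rewrite /T !(aJl, aJr, bJl, bJr) JJx JJh QN.
have sym := curvature_pair_sym Q12 Q34 Qbianchi.
have -> : Q x (- h) (- h) (- x) = - Q x h h x.
  by rewrite (Q12 x) QN (Q12 h) (sym x h) QN (Q12 h) QN !opprK.
have aE' u v : g u xi = 0 -> a u v = g u v by rewrite aE gJ => /JJ->;
  rewrite gN opprK.
have -> : a h x = 0 by rewrite aE' // gsym.
have -> : b x h = g x (J h) by rewrite bE JJh gNr gJ.
by rewrite !aE' // (bS h x) bE JJh gNr -gJ !b0; lra.
Qed.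

End SasakianCurvature.

(** * Levi-Civita connection in a chart *)

Section Inner.
Context {R : realType} {m : nat}.
Implicit Types (A B : 'M[R]_m) (u v w : 'rV[R]_m).

Lemma innerE A u v : inner A u v = \sum_i \sum_j u 0 i * v 0 j * A i j.
Proof.
rewrite /inner mxE exchange_big; apply: eq_bigr => j _ /=.
rewrite !mxE mulr_suml; apply: eq_bigr => i _; ring.
Qed.

Lemma inner_bil A : @bil R m m R (inner A).
Proof.
split=> a u u' w; rewrite /inner.
  by rewrite !mulmxDl -!scalemxAl mxE mxE.
by rewrite linearD linearZ /= mulmxDr -scalemxAr mxE mxE.
Qed.

Lemma innerDl A u v w : inner A (u + v) w = inner A u w + inner A v w.
Proof. exact: bilDl (inner_bil A) _ _ _. Qed.
Lemma innerDr A u v w : inner A w (u + v) = inner A w u + inner A w v.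
Proof. exact: bilDr (inner_bil A) _ _ _. Qed.
Lemma innerZl A a u w : inner A (a *: u) w = a * inner A u w.
Proof. exact: bilZl (inner_bil A) _ _ _. Qed.
Lemma innerZr A a u w : inner A w (a *: u) = a * inner A w u.
Proof. exact: bilZr (inner_bil A) _ _ _. Qed.
Lemma innerNl A u w : inner A (- u) w = - inner A u w.
Proof. exact: bilNl (inner_bil A) _ _. Qed.
Lemma innerNr A u w : inner A w (- u) = - inner A w u.
Proof. exact: bilNr (inner_bil A) _ _. Qed.
Lemma innerBl A u v w : inner A (u - v) w = inner A u w - inner A v w.
Proof. exact: bilBl (inner_bil A) _ _ _. Qed.
Lemma innerBr A u v w : inner A w (u - v) = inner A w u - inner A w v.
Proof. exact: bilBr (inner_bil A) _ _ _. Qed.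
Lemma inner0l A w : inner A 0 w = 0.
Proof. exact: bil0l (inner_bil A) _. Qed.
Lemma inner0r A w : inner A w 0 = 0.
Proof. exact: bil0r (inner_bil A) _. Qed.
Lemma inner_suml A I (s : seq I) (u : I -> 'rV[R]_m) w :
  inner A (\sum_(i <- s) u i) w = \sum_(i <- s) inner A (u i) w.
Proof.
by elim: s => [|i s IHs]; rewrite ?big_nil ?inner0l// !big_cons innerDl IHs.
Qed.
Lemma inner_sumr A I (s : seq I) (u : I -> 'rV[R]_m) w :
  inner A w (\sum_(i <- s) u i) = \sum_(i <- s) inner A w (u i).
Proof.
by elim: s => [|i s IHs]; rewrite ?big_nil ?inner0r// !big_cons innerDr IHs.
Qed.

Lemma inner_mxD A B u v : inner (A + B) u v = inner A u v + inner B u v.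
Proof. by rewrite /inner mulmxDr mulmxDl mxE. Qed.
Lemma inner_mxZ a A u v : inner (a *: A) u v = a * inner A u v.
Proof. by rewrite /inner -scalemxAr -scalemxAl mxE. Qed.

Lemma inner_basis A i j : inner A (basis_vec i) (basis_vec j) = A i j.
Proof. by rewrite /inner /basis_vec -rowE trmx_delta -colE !mxE. Qed.

Lemma inner_eq0 A u : (forall w, w != 0 -> 0 < inner A w w) ->
  (forall w, inner A u w = 0) -> u = 0.
Proof.
move=> posA u0; apply/eqP; apply: contraT => /posA.
by rewrite u0 ltxx.
Qed.

Lemma posdef_unitmx A : (forall w, w != 0 -> 0 < inner A w w) -> A \in unitmx.
Proof.
move=> posA; rewrite -row_free_unit -kermx_eq0;
  apply/rowV0P => v /sub_kermxP vA.
by apply: inner_eq0 posA _ => w; rewrite /inner vA mul0mx mxE.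
Qed.

Lemma sym_mx A : (forall u v, inner A u v = inner A v u) -> A^T = A.
Proof.
by move=> symA; apply/matrixP => i j; rewrite mxE -!inner_basis symA.
Qed.

End Inner.

Section SealedDerivative.
Context {R : realType}.
Implicit Types V W : normedModType R.

(* A copy of [derive] that conversion cannot unfold: comparing ['D_u f x] with
   ['D_v f x] otherwise unfolds both sides down to filters, which makes
   rewriting unusable. *)
Fact dd_sig V W : {D : (V -> W) -> V -> V -> W | derive = D}.
Proof. by exists derive. Qed.

Definition dd V W : (V -> W) -> V -> V -> W := sval (dd_sig V W).

Lemma ddE V W : @derive R V W = @dd V W.
Proof. exact: svalP (dd_sig V W). Qed.

Lemma ddDl V W (f : V -> W) x u v : differentiable f x ->
  dd f x (u + v) = dd f x u + dd f x v.
Proof. by rewrite -ddE; exact: deriveDl. Qed.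

Lemma ddZl V W (f : V -> W) x a v : differentiable f x ->
  dd f x (a *: v) = a *: dd f x v.
Proof. by rewrite -ddE; exact: deriveZl. Qed.

Lemma dd_basis W m (f : 'rV[R]_m -> W) y v : differentiable f y ->
  dd f y v = \sum_i v 0 i *: dd f y (basis_vec i).
Proof. by rewrite -ddE; exact: derive_basis. Qed.

Lemma dd_eq_on V W (U : set V) (f g : V -> W) x v : open U -> U x ->
  (forall y, U y -> f y = g y) -> dd f x v = dd g x v.
Proof. by rewrite -ddE; exact: derive_eq_on. Qed.

Lemma dd_cst V W (w : W) (x v : V) : dd (fun=> w) x v = 0.
Proof. by rewrite -ddE; exact: derive_cst. Qed.

Lemma dd_add V W (f g : V -> W) x v : differentiable f x ->
  differentiable g x -> dd (fun y => f y + g y) x v = dd f x v + dd g x v.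
Proof. by rewrite -ddE; exact: derive_add. Qed.

Lemma dd_opp V W (f : V -> W) x v : differentiable f x ->
  dd (fun y => - f y) x v = - dd f x v.
Proof. by rewrite -ddE; exact: derive_opp. Qed.

Lemma dd_bigsum V W (I : Type) (s : seq I) (h : I -> V -> W) x v :
  (forall i, differentiable (h i) x) ->
  dd (fun y => \sum_(i <- s) h i y) x v = \sum_(i <- s) dd (h i) x v.
Proof. by rewrite -ddE; exact: derive_bigsum. Qed.

Lemma dd_scale V W (a : V -> R) (f : V -> W) x v : differentiable a x ->
  differentiable f x ->
  dd (fun y => a y *: f y) x v = dd a x v *: f x + a x *: dd f x v.
Proof. by move=> da df; rewrite -(ddE V W) -(ddE V R) (derive_scale da df). Qed.

Lemma dd_comp (U V W : normedModType R) (f : U -> V) (g : V -> W) x v :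
  differentiable f x -> differentiable g (f x) ->
  dd (fun y => g (f y)) x v = dd g (f x) (dd f x v).
Proof. by rewrite -!ddE; exact: derive_comp. Qed.

Lemma dd_entry V p q (F : V -> 'M[R]_(p, q)) x v i j :
  differentiable F x -> dd (fun y => F y i j) x v = dd F x v i j.
Proof. by rewrite -!ddE; exact: derive_entry. Qed.

Lemma dd_bilfam V W p q (b : V -> 'rV[R]_p -> 'rV[R]_q -> W) X Y x v :
  (forall y, bil (b y)) -> (forall u w, differentiable (fun y => b y u w) x) ->
  differentiable X x -> differentiable Y x ->
  dd (fun y => b y (X y) (Y y)) x v =
  dd (fun y => b y (X x) (Y x)) x v + b x (dd X x v) (Y x) +
    b x (X x) (dd Y x v).
Proof.
move=> bb db dX dY; rewrite -(ddE V W) -(ddE V 'rV_p) -(ddE V 'rV_q).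
exact: (derive_bilfam bb db dX dY).
Qed.

Lemma dd_schwarz V (U : set V) p q (F : V -> 'M[R]_(p, q)) x u v : open U ->
  U x -> Ck 2 U F -> dd (dd F ^~ v) x u = dd (dd F ^~ u) x v.
Proof. by rewrite -!ddE; exact: schwarz_mx. Qed.

Lemma dd_schwarz_scalar V (U : set V) (F : V -> R) x u v : open U ->
  U x -> Ck 2 U F -> dd (dd F ^~ v) x u = dd (dd F ^~ u) x v.
Proof. by rewrite -!ddE; exact: schwarz. Qed.

Lemma Ck_dd V W k (U : set V) (f : V -> W) v :
  Ck k.+1 U f -> Ck k U (dd f ^~ v).
Proof. by rewrite -!ddE => -[_]; apply. Qed.

Lemma Ck_differentiable V W k (U : set V) (f : V -> W) x :
  Ck k.+1 U f -> U x -> differentiable f x.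
Proof. by case=> df _; exact: df. Qed.

Lemma smooth_dd V W (U : set V) (f : V -> W) v :
  smooth U f -> smooth U (dd f ^~ v).
Proof. by move=> Cf k; apply: Ck_dd; exact: Cf. Qed.

Lemma smooth_differentiable V W (U : set V) (f : V -> W) x :
  smooth U f -> U x -> differentiable f x.
Proof. by move=> Cf; exact: Ck_differentiable (Cf 1%N). Qed.

End SealedDerivative.

Section DeriveInner.
Context {R : realType} {m : nat} {V : normedModType R}.
Variables (G : V -> 'M[R]_m) (x : V).
Hypothesis dG : differentiable G x.

Lemma differentiable_inner_cst u v :
  differentiable (fun y => inner (G y) u v) x.
Proof.
have -> : (fun y => inner (G y) u v) =
    (fun y => \sum_i \sum_j u 0 i * v 0 j * G y i j).
  by apply/funext => y; rewrite innerE.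
apply: differentiable_bigsum => i; apply: differentiable_bigsum => j.
apply: (@differentiable_scale _ R) => //.
exact: differentiable_entry.
Qed.

Lemma dd_inner_cst u v w :
  dd (fun y => inner (G y) u v) x w = inner (dd G x w) u v.
Proof.
have -> : (fun y => inner (G y) u v) =
    (fun y => \sum_i \sum_j u 0 i * v 0 j * G y i j).
  by apply/funext => y; rewrite innerE.
have d i j : differentiable (fun y => u 0 i * v 0 j * G y i j) x.
  apply: (@differentiable_scale _ R) => //.
  exact: differentiable_entry.
rewrite dd_bigsum; last by move=> i; apply: differentiable_bigsum.
rewrite innerE; apply: eq_bigr => i _; rewrite dd_bigsum; last exact: d.
apply: eq_bigr => j _.
have de := differentiable_entry i j dG.
have -> := @dd_scale R _ R (fun=> u 0 i * v 0 j) _ x w (differentiable_cst _ _)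
  de.
by rewrite dd_cst scale0r add0r dd_entry.
Qed.

End DeriveInner.

(** A metric on an open set, detached from any manifold, so that the local theory also applies to
    overlaps of charts. *)
Record riemannian {R : realType} {m : nat} (U : set 'rV[R]_m)
    (G : 'rV[R]_m -> 'M[R]_m) : Prop := Riemannian {
  riemannian_open : open U;
  riemannian_smooth : smooth U G;
  riemannian_sym : forall y u v, U y -> inner (G y) u v = inner (G y) v u;
  riemannian_pos : forall y u, U y -> u != 0 -> 0 < inner (G y) u u }.

(** The right-hand side of the Koszul formula for constant vector fields, whose brackets vanish:
    twice the Christoffel symbol of the first kind. *)
Definition koszul {R : realType} {m : nat} (G : 'rV[R]_m -> 'M[R]_m)
    y u v w : R :=
  inner (dd G y u) v w + inner (dd G y v) u w - inner (dd G y w) u v.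

Section LeviCivita.
Context {R : realType} {m : nat}.
Variables (U : set 'rV[R]_m) (G : 'rV[R]_m -> 'M[R]_m).
Hypothesis rG : riemannian U G.

Let oU := riemannian_open rG.
Let CG := riemannian_smooth rG.
Let symG := riemannian_sym rG.
Let posG := riemannian_pos rG.

Lemma metric_differentiable y : U y -> differentiable G y.
Proof. by have [dG _] := CG 1; exact: dG. Qed.

Lemma metric_unitmx y : U y -> G y \in unitmx.
Proof. by move=> Uy; apply: posdef_unitmx => w; exact: posG. Qed.

Lemma dd_metric_sym y u v w : U y ->
  inner (dd G y w) u v = inner (dd G y w) v u.
Proof.
move=> Uy; have dG := metric_differentiable Uy.
rewrite -!(dd_inner_cst dG).
by apply: dd_eq_on Uy _ => // z Uz; exact: symG.
Qed.

Lemma koszulDl y a u u' v w : U y ->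
  koszul G y (a *: u + u') v w = a * koszul G y u v w + koszul G y u' v w.
Proof.
move=> Uy; have dG := metric_differentiable Uy; rewrite /koszul ddDl// ddZl//.
by rewrite inner_mxD inner_mxZ !innerDl !innerZl; ring.
Qed.

Lemma koszulDr y a u u' v w : U y ->
  koszul G y v (a *: u + u') w = a * koszul G y v u w + koszul G y v u' w.
Proof.
move=> Uy; have dG := metric_differentiable Uy; rewrite /koszul ddDl// ddZl//.
by rewrite inner_mxD inner_mxZ innerDl innerDr innerZl innerZr; ring.
Qed.

Lemma koszul_bil y w : U y -> @bil R m m R (fun u v => koszul G y u v w).
Proof.
by move=> Uy; split=> a u u' v; [exact: koszulDl|exact: koszulDr].
Qed.

Lemma koszul_linear y u v w : U y ->
  koszul G y u v w = \sum_l koszul G y u v (basis_vec l) * w 0 l.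
Proof.
move=> Uy; have dG := metric_differentiable Uy.
have E w' : koszul G y u v w' = inner (dd G y u) v w' + inner (dd G y v) u w' -
  inner (dd G y w') u v by [].
rewrite E {1 2}[w]row_sum_delta !inner_sumr (dd_basis w dG).
have -> : inner (\sum_i w 0 i *: dd G y (basis_vec i)) u v =
    \sum_i w 0 i * inner (dd G y (basis_vec i)) u v.
  elim/big_rec2: _ => [|i a A _ IH]; last by rewrite inner_mxD inner_mxZ IH.
  by rewrite /inner mulmx0 mul0mx mxE.
rewrite -big_split -sumrB /=; apply: eq_bigr => l _.
by rewrite E !innerZr mulrBl mulrDl ![_ * w 0 l]mulrC.
Qed.

Lemma gammaE y u v : U y ->
  gamma G y u v =
  2^-1 *: ((\row_l koszul G y u v (basis_vec l)) *m invmx (G y)).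
Proof.
move=> Uy; have dG := metric_differentiable Uy.
have symi : (invmx (G y))^T = invmx (G y).
  by rewrite trmx_inv sym_mx// => *; exact: symG.
apply/rowP => k; rewrite !mxE mulr_sumr.
under [RHS]eq_bigr => l _.
  rewrite mxE (bil_expand (koszul_bil (basis_vec l) Uy)) mulr_suml mulr_sumr.
  under eq_bigr do rewrite mulr_suml mulr_sumr.
  over.
rewrite [RHS]exchange_big; apply: eq_bigr => i _ /=.
rewrite [RHS]exchange_big; apply: eq_bigr => j _ /=.
rewrite /christoffel !mulr_sumr; apply: eq_bigr => l _.
have -> : invmx (G y) l k = invmx (G y) k l by rewrite -{1}symi mxE.
rewrite /koszul !inner_basis ddE !dd_entry//.
by rewrite -[(_ * _) *: _]/(_ * _ * _); ring.
Qed.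

Lemma koszul_formula y u v w : U y ->
  inner (G y) (gamma G y u v) w = 2^-1 * koszul G y u v w.
Proof.
move=> Uy; rewrite gammaE// innerZl /inner mulmxKV ?metric_unitmx//.
rewrite (koszul_linear u v w Uy) mxE; congr (_ * _); apply: eq_bigr => l _.
by rewrite !mxE.
Qed.

Lemma gamma_bil y : bil (gamma G y).
Proof.
split=> a u u' v; apply/rowP => k; rewrite !mxE mulr_sumr -big_split /=;
  apply: eq_bigr => i _; rewrite mulr_sumr -big_split /=; apply: eq_bigr => j _;
  by rewrite !mxE; ring.
Qed.

Lemma gamma_sym y u v : U y -> gamma G y u v = gamma G y v u.
Proof.
move=> Uy; rewrite !gammaE//; congr (_ *: (_ *m _)); apply/rowP => l.
rewrite !mxE /koszul (dd_metric_sym u v _ Uy).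
by congr (_ - _); rewrite addrC.
Qed.

(** Metric compatibility: in the sum of the two Koszul expressions only the derivative of the metric
    along [w] survives, twice. *)
Lemma gamma_metric y u v w : U y ->
  dd (fun z => inner (G z) u v) y w =
  inner (G y) (gamma G y w u) v + inner (G y) u (gamma G y w v).
Proof.
move=> Uy; rewrite [inner _ u _]symG// !koszul_formula// /koszul.
rewrite dd_inner_cst; last exact: metric_differentiable.
by rewrite (dd_metric_sym v u) //; field.
Qed.

Lemma smooth_gamma k u v : Ck k U (fun y => gamma G y u v).
Proof.
apply: (@Ck_ext _ _ _ _ _ (fun y =>
  2^-1 *: ((\row_l koszul G y u v (basis_vec l)) *m invmx (G y)))) => //.
  by move=> y Uy; rewrite gammaE.
apply: Ck_scale => //; first exact: Ck_cst.
have Ci i j : Ck k U (fun y => invmx (G y) i j).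
  apply: Ck_entry => //; apply: Ck_invmx (CG k) => //.
  exact: metric_unitmx.
have Cin w u' v' : Ck k U (fun y => inner (dd G y w) u' v').
  apply: (@Ck_ext _ _ R _ _ (fun y => \sum_i \sum_j u' 0 i * v' 0 j *
    dd G y w i j)) => //; first by move=> y _; rewrite innerE.
  apply: Ck_sum => // i _; apply: Ck_sum => // j _; apply: Ck_mul => //.
    exact: Ck_cst.
  by apply: Ck_entry => //; apply: Ck_dd; exact: CG.
apply: Ck_mx => // i j.
apply: (@Ck_ext _ _ R _ _ (fun y => \sum_l
  koszul G y u v (basis_vec l) * invmx (G y) l j)) => //.
  by move=> y _; rewrite !mxE; apply: eq_bigr => l _; rewrite !mxE.
apply: Ck_sum => // l _; apply: Ck_mul => //.
by apply: Ck_sub => //; apply: Ck_add.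
Qed.

End LeviCivita.

(** * Connections along maps *)

Section Along.
Context {R : realType}.

(** [cova] and [nab] restate [covD_along] and [nabla_df] with the sealed derivative [dd] and with
    tangent vectors, not fields, as directions. *)
Definition cova {n m : nat} (H : 'rV[R]_m -> 'M[R]_m) (f : 'rV[R]_n -> 'rV[R]_m)
    (V : 'rV[R]_n -> 'rV[R]_m) x u : 'rV[R]_m :=
  dd V x u + gamma H (f x) (dd f x u) (V x).

Definition nab {n m : nat} (G : 'rV[R]_n -> 'M[R]_n) (H : 'rV[R]_m -> 'M[R]_m)
    (f : 'rV[R]_n -> 'rV[R]_m) x u v : 'rV[R]_m :=
  cova H f (dd f ^~ v) x u - dd f x (gamma G x u v).

Lemma covaE n m (H : 'rV[R]_m -> 'M[R]_m) (f : 'rV[R]_n -> 'rV[R]_m) X V x :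
  covD_along H f X V x = cova H f V x (X x).
Proof. by rewrite /covD_along ddE. Qed.

Lemma covD_cst n (G : 'rV[R]_n -> 'M[R]_n) u v x :
  covD G (fun=> u) (fun=> v) x = gamma G x u v.
Proof. by rewrite /covD ddE dd_cst add0r. Qed.

Lemma nabE n m (G : 'rV[R]_n -> 'M[R]_n) (H : 'rV[R]_m -> 'M[R]_m)
    (f : 'rV[R]_n -> 'rV[R]_m) x u v :
  nabla_df G H f (fun=> u) (fun=> v) x = nab G H f x u v.
Proof. by rewrite /nabla_df covaE covD_cst ddE. Qed.

Section OneMap.
Variables (n m : nat) (Uf : set 'rV[R]_n) (U : set 'rV[R]_m).
Variables (H : 'rV[R]_m -> 'M[R]_m) (f : 'rV[R]_n -> 'rV[R]_m).
Hypotheses (rH : riemannian U H) (oUf : open Uf) (Cf : smooth Uf f).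
Hypothesis fU : forall x, Uf x -> U (f x).
Implicit Types V W : 'rV[R]_n -> 'rV[R]_m.

Lemma smooth_gamma_along k V W : Ck k Uf V -> Ck k Uf W ->
  Ck k Uf (fun x => gamma H (f x) (V x) (W x)).
Proof.
move=> CV CW; apply: (@Ck_bil _ _ _ _ _ (fun y => gamma H (f y))) => //.
  by move=> y; exact: gamma_bil.
move=> u w; exact: (Ck_comp oUf fU (Cf k) (smooth_gamma rH k u w)).
Qed.

Lemma Ck_inner_along k V W : Ck k Uf V -> Ck k Uf W ->
  Ck k Uf (fun x => inner (H (f x)) (V x) (W x)).
Proof.
move=> CV CW.
apply: (@Ck_bil _ _ R _ _ (fun y => inner (H (f y)) : _ -> _ -> R)) => //.
  by move=> y; exact: inner_bil.
move=> u w; apply: (@Ck_comp _ _ _ _ _ _ _ f (fun z => inner (H z) u w) oUf fU).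
  exact: (Cf k).
apply: (@Ck_ext _ _ R _ _ (fun y => \sum_i \sum_j u 0 i * w 0 j * H y i j)).
- exact: riemannian_open rH.
- by move=> y _; rewrite innerE.
have oU := riemannian_open rH.
apply: Ck_sum => // i _; apply: Ck_sum => // j _; apply: Ck_mul => //.
  exact: Ck_cst.
by apply: Ck_entry => //; exact: riemannian_smooth rH k.
Qed.

Lemma smooth_cova V u : smooth Uf V -> smooth Uf (cova H f V ^~ u).
Proof.
move=> CV k; apply: Ck_add => //; first exact: smooth_dd.
by apply: smooth_gamma_along; [exact: smooth_dd|exact: CV].
Qed.

Lemma dd_inner_along V W x u : Uf x -> differentiable V x ->
  differentiable W x ->
  dd (fun y => inner (H (f y)) (V y) (W y)) x u =
  inner (H (f x)) (cova H f V x u) (W x) +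
    inner (H (f x)) (V x) (cova H f W x u).
Proof.
move=> Ux dV dW; have dH := metric_differentiable rH (fU Ux).
have df := smooth_differentiable Cf Ux.
have d a b : differentiable (fun y => inner (H (f y)) a b) x.
  apply: (@differentiable_comp _ _ _ _ f (fun z => inner (H z) a b)) => //.
  exact: differentiable_inner_cst.
have -> := @dd_bilfam _ _ R _ _ (fun y => inner (H (f y)) : _ -> _ -> R) V W x u
  (fun y => inner_bil _) d dV dW.
have -> := @dd_comp _ _ _ _ f (fun z => inner (H z) (V x) (W x)) x u df
  (differentiable_inner_cst dH _ _).
rewrite (gamma_metric rH _ _ _ (fU Ux)) /cova innerDl innerDr; ring.
Qed.

(** Symmetry of second derivatives together with vanishing torsion. *)
Lemma cova_sym x u v : Uf x ->
  cova H f (dd f ^~ v) x u = cova H f (dd f ^~ u) x v.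
Proof.
move=> Ux; rewrite /cova (dd_schwarz u v oUf Ux (Cf 2)).
by rewrite (gamma_sym rH _ _ (fU Ux)).
Qed.

Lemma cova_add V W x u : differentiable V x -> differentiable W x ->
  cova H f (fun y => V y + W y) x u = cova H f V x u + cova H f W x u.
Proof.
move=> dV dW; rewrite /cova dd_add// (bilDr (gamma_bil _ _)); exact: addrACA.
Qed.

Lemma covaDl V x u u' : Uf x -> differentiable V x ->
  cova H f V x (u + u') = cova H f V x u + cova H f V x u'.
Proof.
move=> Ux dV; have df := smooth_differentiable Cf Ux.
by rewrite /cova ddDl// ddDl// (bilDl (gamma_bil _ _)); exact: addrACA.
Qed.

Lemma covaZl V x a u : Uf x -> differentiable V x ->
  cova H f V x (a *: u) = a *: cova H f V x u.
Proof.
move=> Ux dV; have df := smooth_differentiable Cf Ux.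
by rewrite /cova ddZl// ddZl// (bilZl (gamma_bil _ _)) scalerDr.
Qed.

(** Here [v] sits under the derivative; [cova_sym] moves it to the direction slot, where linearity
    is immediate. *)
Lemma cova_dfDr x u v v' a : Uf x ->
  cova H f (dd f ^~ (a *: v + v')) x u =
  a *: cova H f (dd f ^~ v) x u + cova H f (dd f ^~ v') x u.
Proof.
move=> Ux; rewrite cova_sym// (cova_sym u v)// (cova_sym u v')//.
have d := smooth_differentiable (smooth_dd u Cf) Ux.
by rewrite covaDl// covaZl.
Qed.

Lemma nab_bil (G : 'rV[R]_n -> 'M[R]_n) x : Uf x -> bil (nab G H f x).
Proof.
move=> Ux; have df := smooth_differentiable Cf Ux.
split=> a u u' w; rewrite /nab.
  have d := smooth_differentiable (smooth_dd w Cf) Ux.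
  rewrite covaDl// covaZl// (gamma_bil G x).1 ddDl// ddZl//.
  by rewrite scalerBr opprD addrACA.
rewrite cova_dfDr// (gamma_bil G x).2 ddDl// ddZl//.
by rewrite scalerBr opprD addrACA.
Qed.

Section Isometric.
Variable G : 'rV[R]_n -> 'M[R]_n.
Hypothesis rG : riemannian Uf G.
Hypothesis isoG : forall x u v, Uf x ->
  inner (G x) u v = inner (H (f x)) (dd f x u) (dd f x v).

(** The form [S], symmetric in its first two slots, expresses the derivatives of the induced metric;
    substituted in the Koszul formula, they leave 2 S. So the tangential part of the ambient
    derivative is intrinsic. *)
Lemma gauss x u v w : Uf x ->
  inner (G x) (gamma G x u v) w =
  inner (H (f x)) (cova H f (dd f ^~ v) x u) (dd f x w).
Proof.
move=> Ux; have dG := metric_differentiable rG Ux.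
have df z := smooth_differentiable (smooth_dd z Cf) Ux.
pose S a b c := inner (H (f x)) (cova H f (dd f ^~ b) x a) (dd f x c).
have DS a b c : inner (dd G x a) b c = S a b c + S a c b.
  rewrite -dd_inner_cst//.
  have -> : dd (fun y => inner (G y) b c) x a =
      dd (fun y => inner (H (f y)) (dd f y b) (dd f y c)) x a.
    apply: (dd_eq_on _ oUf Ux) => y Uy; exact (isoG b c Uy).
  rewrite dd_inner_along//; congr (_ + _).
  by rewrite /S (riemannian_sym rH _ _ (fU Ux)).
have Ssym a b c : S a b c = S b a c by rewrite /S cova_sym.
rewrite (koszul_formula rG _ _ _ Ux) /koszul !DS.
rewrite (Ssym v u w) (Ssym u w v) (Ssym v w u) -/(S u v w).
by field.
Qed.

Lemma nab_normal x u v w : Uf x ->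
  inner (H (f x)) (nab G H f x u v) (dd f x w) = 0.
Proof. by move=> Ux; rewrite /nab innerBl -isoG// gauss// subrr. Qed.

End Isometric.

End OneMap.

(** Both the base point and the direction of [dd th] move with [y]; the basis expansion separates
    the two variations. *)
Lemma dd_dd_along n m p (Uf : set 'rV[R]_n) (U : set 'rV[R]_m)
    (f V : 'rV[R]_n -> 'rV[R]_m) (th : 'rV[R]_m -> 'rV[R]_p) x u :
  open Uf -> open U -> smooth Uf f -> smooth U th ->
  (forall y, Uf y -> U (f y)) -> Uf x -> differentiable V x ->
  dd (fun y => dd th (f y) (V y)) x u =
  dd (dd th ^~ (V x)) (f x) (dd f x u) + dd th (f x) (dd V x u).
Proof.
move=> oUf oU Cf Cth fU Ux dV; have df := smooth_differentiable Cf Ux.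
have dth z (Uz : Uf z) := smooth_differentiable Cth (fU z Uz).
have dthe i : differentiable (dd th ^~ (basis_vec i)) (f x).
  exact: smooth_differentiable (smooth_dd _ Cth) (fU _ Ux).
have dc i : differentiable (fun y => dd th (f y) (basis_vec i)) x.
  exact: (@differentiable_comp _ _ _ _ f (fun z => dd th z (basis_vec i))).
have -> : dd (fun y => dd th (f y) (V y)) x u =
    dd (fun y => \sum_i V y 0 i *: dd th (f y) (basis_vec i)) x u.
  by apply: (dd_eq_on _ oUf Ux) => y Uy; exact: dd_basis (dth y Uy).
have -> : dd (dd th ^~ (V x)) (f x) (dd f x u) =
    dd (fun z => \sum_i V x 0 i *: dd th z (basis_vec i)) (f x) (dd f x u).
  apply: (dd_eq_on _ oU (fU _ Ux)) => y Uy.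
  exact: dd_basis (smooth_differentiable Cth Uy).
have dVi i : differentiable (fun y => V y 0 i) x by exact: differentiable_entry.
rewrite dd_bigsum; last by move=> i; exact: differentiable_scale.
rewrite dd_bigsum; last by move=> i; apply: differentiable_scale.
rewrite (dd_basis (dd V x u) (dth x Ux)) -big_split; apply: eq_bigr => i _ /=.
rewrite (dd_scale _ (dVi i) (dc i)).
rewrite (dd_scale _ (differentiable_cst (V x 0 i : R) (f x)) (dthe i)).
rewrite dd_cst scale0r add0r dd_entry// addrC; congr (_ *: _ + _).
by have -> := dd_comp u df (dthe i).
Qed.

(** The connection of the intermediate metric [H] enters the first summand and is subtracted again
    in the second. *)
Lemma nab_comp n m p (Uf : set 'rV[R]_n) (U : set 'rV[R]_m)
    (G : 'rV[R]_n -> 'M[R]_n) (H : 'rV[R]_m -> 'M[R]_m)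
    (K : 'rV[R]_p -> 'M[R]_p)
    (f : 'rV[R]_n -> 'rV[R]_m) (th : 'rV[R]_m -> 'rV[R]_p) x u v :
  open Uf -> open U -> smooth Uf f -> smooth U th ->
  (forall y, Uf y -> U (f y)) -> Uf x ->
  nab G K (fun y => th (f y)) x u v =
  dd th (f x) (nab G H f x u v) + nab H K th (f x) (dd f x u) (dd f x v).
Proof.
move=> oUf oU Cf Cth fU Ux;
  have df y (Uy : Uf y) := smooth_differentiable Cf Uy.
have dth y (Uy : Uf y) := smooth_differentiable Cth (fU y Uy).
have dfv := smooth_differentiable (smooth_dd v Cf) Ux.
have D w : dd (fun y => th (f y)) x w = dd th (f x) (dd f x w).
  by rewrite dd_comp//; [exact: df|exact: dth].
rewrite /nab /cova !D.
have -> : dd (dd (fun y => th (f y)) ^~ v) x u =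
    dd (fun y => dd th (f y) (dd f y v)) x u.
  apply: (dd_eq_on _ oUf Ux) => y Uy; rewrite dd_comp//; [exact: df|exact: dth].
rewrite (dd_dd_along u oUf oU Cf Cth fU Ux dfv).
have dx := dth x Ux.
have ddB a b : dd th (f x) (a - b) = dd th (f x) a - dd th (f x) b.
  by rewrite ddDl// -[- b]scaleN1r ddZl// scaleN1r.
rewrite ddB ddDl//.
set A := dd (dd th ^~ _) _ _; set B := dd th _ (dd _ _ _);
  set C := gamma K _ _ _.
set D1 := dd th _ (dd f _ _); set D2 := dd th _ (gamma H _ _ _).
by apply/rowP => i; rewrite !mxE; ring.
Qed.

End Along.

(** * Curvature tensor *)

Section CurvatureTensor.
Context {R : realType} {m : nat}.
Implicit Types (G : 'rV[R]_m -> 'M[R]_m) (Y Z : 'rV[R]_m -> 'rV[R]_m).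

Definition cov G Y x u : 'rV[R]_m := dd Y x u + gamma G x u (Y x).

(** The bracket term of [curvature] is absent because constant fields commute. *)
Definition rm G x u v w : 'rV[R]_m :=
  cov G (fun y => gamma G y v w) x u - cov G (fun y => gamma G y u w) x v.

Lemma covDE G X Y x : covD G X Y x = cov G Y x (X x).
Proof. by rewrite /covD ddE. Qed.

Lemma cov_cst G w x u : cov G (fun=> w) x u = gamma G x u w.
Proof. by rewrite /cov dd_cst add0r. Qed.

Lemma riemannE G x u v w : riemann G x u v w = rm G x u v w.
Proof.
have E a b : covD G (fun=> a) (fun=> b) = fun y => gamma G y a b.
  by apply/funext => y; rewrite covDE cov_cst.
rewrite /riemann /curvature !E !covDE cov_cst /lie_bracket ddE !dd_cst subrr.
by rewrite (bil0l (gamma_bil G x)) subr0.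
Qed.

(** Makes the results on connections along maps available on the chart itself. *)
Lemma cova_id G Y x u : cova G id Y x u = cov G Y x u.
Proof. by rewrite /cova /cov -ddE derive_id. Qed.

Variables (U : set 'rV[R]_m) (G : 'rV[R]_m -> 'M[R]_m).
Hypothesis rG : riemannian U G.
Let oU := riemannian_open rG.

Lemma smooth_id (V : normedModType R) (D : set V) : smooth D (id : V -> V).
Proof.
case=> [|k]; first by move=> x _; exact: cvg_id.
split=> [x _|v]; first exact: (@ex_diff _ _ _ _ _ id id).
have -> : 'D_v (id : V -> V) = fun=> v by apply/funext => x; exact: derive_id.
exact: Ck_cst.
Qed.

Lemma dd_inner Y Z x u : U x -> differentiable Y x -> differentiable Z x ->
  dd (fun y => inner (G y) (Y y) (Z y)) x u =
  inner (G x) (cov G Y x u) (Z x) + inner (G x) (Y x) (cov G Z x u).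
Proof.
move=> Ux dY dZ; rewrite -!cova_id.
exact: (@dd_inner_along _ _ _ U U G id rG (smooth_id U) (fun _ => id)).
Qed.

Lemma differentiable_gamma x u v : U x ->
  differentiable (fun y => gamma G y u v) x.
Proof. exact: Ck_differentiable (smooth_gamma rG 1 u v). Qed.

Lemma cov_eq_on Y Z x u : U x -> (forall y, U y -> Y y = Z y) ->
  cov G Y x u = cov G Z x u.
Proof. by move=> Ux YZ; rewrite /cov (dd_eq_on _ oU Ux YZ) YZ. Qed.

Lemma cov_add Y Z x u : differentiable Y x -> differentiable Z x ->
  cov G (fun y => Y y + Z y) x u = cov G Y x u + cov G Z x u.
Proof.
by move=> dY dZ; rewrite /cov dd_add// (bilDr (gamma_bil _ _)); exact: addrACA.
Qed.

Lemma cov_scale (a : 'rV[R]_m -> R) Y x u : differentiable a x ->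
  differentiable Y x ->
  cov G (fun y => a y *: Y y) x u = dd a x u *: Y x + a x *: cov G Y x u.
Proof.
move=> da dY; rewrite /cov dd_scale// (bilZr (gamma_bil _ _)) scalerDr.
by rewrite addrA.
Qed.

Lemma cov_linear a Y Z x u : differentiable Y x -> differentiable Z x ->
  cov G (fun y => a *: Y y + Z y) x u = a *: cov G Y x u + cov G Z x u.
Proof.
move=> dY dZ; have da := @differentiable_cst R 'rV[R]_m R a x.
rewrite (cov_add u (differentiable_scale da dY) dZ) (cov_scale u da dY).
by rewrite dd_cst scale0r add0r.
Qed.

Lemma cov_opp Y x u : differentiable Y x ->
  cov G (fun y => - Y y) x u = - cov G Y x u.
Proof. by move=> dY; rewrite /cov dd_opp// (bilNr (gamma_bil _ _)) opprD. Qed.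

Lemma covDl Y x a u u' : U x -> differentiable Y x ->
  cov G Y x (a *: u + u') = a *: cov G Y x u + cov G Y x u'.
Proof.
move=> Ux dY; rewrite /cov ddDl// ddZl// (gamma_bil G x).1 scalerDr.
exact: addrACA.
Qed.

Lemma dd_gamma Y Z x u : U x -> differentiable Y x -> differentiable Z x ->
  dd (fun y => gamma G y (Y y) (Z y)) x u =
  dd (fun y => gamma G y (Y x) (Z x)) x u +
  gamma G x (dd Y x u) (Z x) + gamma G x (Y x) (dd Z x u).
Proof.
move=> Ux dY dZ; have d a b := differentiable_gamma a b Ux.
exact: (@dd_bilfam _ _ _ _ _ (gamma G) Y Z x u (gamma_bil G) d dY dZ).
Qed.

(** Tensoriality in the last slot: the derivatives of [Z] cancel by Schwarz and by symmetry in [u],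
    [v]. It allows the nonconstant field w phi in [rm_phi]. *)
Lemma ricci_identity Z x u v : U x -> smooth U Z ->
  cov G (cov G Z ^~ v) x u - cov G (cov G Z ^~ u) x v = rm G x u v (Z x).
Proof.
move=> Ux CZ; have dZ := smooth_differentiable CZ Ux.
have dc (a : 'rV[R]_m) := @differentiable_cst R _ _ a x.
have E a b : cov G (cov G Z ^~ b) x a = dd (dd Z ^~ b) x a +
    (dd (fun y => gamma G y b (Z x)) x a + gamma G x b (dd Z x a)) +
    (gamma G x a (dd Z x b) + gamma G x a (gamma G x b (Z x))).
  have dZb := smooth_differentiable (smooth_dd b CZ) Ux.
  have dg : differentiable (fun y => gamma G y b (Z y)) x.
    apply: (@differentiable_bilfam _ _ _ _ _ (gamma G) (gamma_bil G)
      (fun=> b) Z) => //.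
    by move=> *; exact: differentiable_gamma.
  rewrite {1}/cov dd_add// (dd_gamma a Ux (dc b) dZ) dd_cst.
  by rewrite (bil0l (gamma_bil G x)) addr0 /cov (bilDr (gamma_bil G x)).
rewrite !E (dd_schwarz u v oU Ux (CZ 2)) /rm /cov.
by apply/rowP => i; rewrite !mxE; ring.
Qed.

Lemma rm_sym x u v w : rm G x u v w = - rm G x v u w.
Proof. by rewrite /rm opprB. Qed.

Lemma rm_linear x a u u' v w : U x ->
  rm G x (a *: u + u') v w = a *: rm G x u v w + rm G x u' v w.
Proof.
move=> Ux; have d b c := differentiable_gamma b c Ux.
rewrite /rm covDl//.
have -> : (fun y => gamma G y (a *: u + u') w) =
    (fun y => a *: gamma G y u w + gamma G y u' w).
  by apply/funext => y; rewrite (gamma_bil G y).1.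
by rewrite (cov_linear _ _ (d u w) (d u' w)) scalerBr opprD addrACA.
Qed.

Lemma rm_linear3 x a u v w w' : U x ->
  rm G x u v (a *: w + w') = a *: rm G x u v w + rm G x u v w'.
Proof.
move=> Ux; have d b c := differentiable_gamma b c Ux.
have E b : (fun y => gamma G y b (a *: w + w')) =
    (fun y => a *: gamma G y b w + gamma G y b w').
  by apply/funext => y; rewrite (gamma_bil G y).2.
rewrite /rm !E (cov_linear _ _ (d v w) (d v w')) (cov_linear _ _ (d u w)
  (d u w')).
by rewrite scalerBr opprD addrACA.
Qed.

Lemma rm_bianchi x u v w : U x ->
  rm G x u v w + rm G x v w u + rm G x w u v = 0.
Proof.
move=> Ux; rewrite /rm.
have E a b c : cov G (fun y => gamma G y a b) x c =
    cov G (fun y => gamma G y b a) x c.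
  by apply: cov_eq_on Ux _ => y Uy; rewrite (gamma_sym rG).
rewrite (E w u) (E v u) (E w v).
by apply/rowP => i; rewrite !mxE; ring.
Qed.

(** Differentiate the function <w, z> along [u] and [v] in both orders: by Schwarz the results
    agree, and the products of first derivatives cancel. *)
Lemma rm_skew x u v w z : U x ->
  inner (G x) (rm G x u v w) z = - inner (G x) (rm G x u v z) w.
Proof.
move=> Ux; have dc (a : 'rV[R]_m) y := @differentiable_cst R 'rV[R]_m _ a y.
have d b c := differentiable_gamma b c Ux.
have D1 a : {in U, dd (fun y => inner (G y) w z) ^~ a =1
    fun y => inner (G y) (gamma G y a w) z + inner (G y) w (gamma G y a z)}.
  by move=> y /set_mem Uy; rewrite (dd_inner a Uy (dc w y) (dc z y)) !cov_cst.
have D2 a b : dd (dd (fun y => inner (G y) w z) ^~ b) x a =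
    inner (G x) (cov G (fun y => gamma G y b w) x a) z +
    inner (G x) (gamma G x b w) (gamma G x a z) +
    (inner (G x) (gamma G x a w) (gamma G x b z) +
    inner (G x) w (cov G (fun y => gamma G y b z) x a)).
  rewrite (dd_eq_on _ oU Ux (fun y Uy => D1 b y (mem_set Uy))).
  have di V W : differentiable V x -> differentiable W x ->
      differentiable (fun y => inner (G y) (V y) (W y)) x.
    move=> dV dW.
    apply: (@differentiable_bilfam _ _ R _ _ (fun y => inner (G y) : _ -> _ ->
      R)
      (fun y => inner_bil _) V W) => //.
    by move=> a' b'; exact: differentiable_inner_cst (metric_differentiable rG
      Ux) _ _.
  rewrite dd_add; [|exact: di|exact: di].
  by rewrite !dd_inner// !cov_cst.
have C2 : Ck 2 U (fun y => inner (G y) w z).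
  apply: (@Ck_inner_along _ _ _ U U G id rG oU (smooth_id U) (fun _ => id)) =>
    //.
  - exact: Ck_cst.
  - exact: Ck_cst.
have := dd_schwarz_scalar u v oU Ux C2; rewrite !D2 /rm !innerBl.
rewrite !(riemannian_sym rG w _ Ux).
set a1 := inner _ _ _; set a2 := inner _ _ _; set a3 := inner _ _ _.
set a4 := inner _ _ _; set a5 := inner _ _ _; set a6 := inner _ _ _.
by move=> E; lra.
Qed.

End CurvatureTensor.

(** * Sasakian structures in a chart *)

Section SasakianChart.
Context {R : realType} {m : nat}.
Variables (U : set 'rV[R]_m) (G phi : 'rV[R]_m -> 'M[R]_m).
Variables (xi : 'rV[R]_m -> 'rV[R]_m) (eta : 'rV[R]_m -> 'cV[R]_m) (c : R).
Hypothesis rG : riemannian U G.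
Hypotheses (Cphi : smooth U phi) (Cxi : smooth U xi).
Hypothesis phi2 : forall x u, U x ->
  u *m phi x *m phi x = - u + pairing (eta x) u *: xi x.
Hypothesis eta_xi : forall x, U x -> pairing (eta x) (xi x) = 1.
Hypothesis compat : forall x u v, U x ->
  inner (G x) (u *m phi x) (v *m phi x) =
  inner (G x) u v - pairing (eta x) u * pairing (eta x) v.
Hypothesis phi_skew : forall x u v, U x ->
  inner (G x) u (v *m phi x) = - inner (G x) v (u *m phi x).
Hypothesis sasaki : forall (V : 'rV[R]_m -> 'rV[R]_m) x u, smooth U V -> U x ->
  cov G (fun y => V y *m phi y) x u - cov G V x u *m phi x =
  inner (G x) u (V x) *: xi x - pairing (eta x) (V x) *: u.
Hypothesis phi_sectional : forall x u, U x ->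
  inner (G x) u u = 1 -> inner (G x) u (xi x) = 0 ->
  sectional G x u (u *m phi x) = c.

Let oU := riemannian_open rG.
Let symG := riemannian_sym rG.

(** Skewness gives |phi xi|^2 = - <xi, phi phi xi>, and [phi2] makes phi phi xi zero. *)
Lemma phi_xi x : U x -> xi x *m phi x = 0.
Proof.
move=> Ux; apply/eqP; apply: contraT => nz.
have := riemannian_pos rG Ux nz;
  rewrite phi_skew// phi2// eta_xi// scale1r addNr.
by rewrite inner0r oppr0 ltxx.
Qed.

Lemma eta_inner x u : U x -> pairing (eta x) u = inner (G x) u (xi x).
Proof.
move=> Ux; have := compat u (xi x) Ux; rewrite phi_xi// inner0r eta_xi// mulr1.
by move/esym/subr0_eq.
Qed.

Lemma xi_unit x : U x -> inner (G x) (xi x) (xi x) = 1.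
Proof. by move=> Ux; rewrite -eta_inner// eta_xi. Qed.

Lemma phi_xi_orth x u : U x -> inner (G x) (u *m phi x) (xi x) = 0.
Proof. by move=> Ux; rewrite symG// phi_skew// phi_xi// inner0r oppr0. Qed.

Lemma smooth_phi (V : 'rV[R]_m -> 'rV[R]_m) : smooth U V ->
  smooth U (fun y => V y *m phi y).
Proof.
move=> CV k; apply: Ck_mx => // i j.
apply: (@Ck_ext _ _ R _ _ (fun y => \sum_l V y i l * phi y l j)) => //.
  by move=> y _; rewrite mxE.
by apply: Ck_sum => // l _; apply: Ck_mul => //; apply: Ck_entry.
Qed.

(** Take V = xi in [sasaki] and apply [phi] once more. As xi has constant length, its derivative is
    orthogonal to xi, where [phi] squares to - 1. *)
Lemma cov_xi x u : U x -> cov G xi x u = - (u *m phi x).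
Proof.
move=> Ux; have dxi := smooth_differentiable Cxi Ux.
have := sasaki u Cxi Ux; rewrite eta_xi// scale1r.
have -> : cov G (fun y => xi y *m phi y) x u = 0.
  have -> := @cov_eq_on _ _ _ _ rG (fun y =>
    xi y *m phi y) (fun=> 0) x u Ux phi_xi.
  by rewrite cov_cst (bil0r (gamma_bil G x)).
rewrite sub0r => /(congr1 (mulmx^~ (phi x))).
rewrite mulNmx mulmxBl -scalemxAl phi_xi// scaler0 sub0r phi2//.
have -> : pairing (eta x) (cov G xi x u) = 0.
  have : dd (fun y => inner (G y) (xi y) (xi y)) x u = 0.
    rewrite (@dd_eq_on _ _ R U _ (fun=> 1) x u oU Ux xi_unit).
    exact: dd_cst.
  rewrite (dd_inner rG)// eta_inner// [inner _ (xi x) _]symG//; lra.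
by rewrite scale0r addr0 opprK.
Qed.

(** The failure of the curvature to commute with [phi] is the Ricci identity for the field w phi,
    whose covariant derivatives are known from [sasaki]. *)
Lemma rm_phi x u v w : U x ->
  rm G x u v (w *m phi x) = rm G x u v w *m phi x
    - inner (G x) v w *: (u *m phi x) + inner (G x) u w *: (v *m phi x)
    + inner (G x) w (u *m phi x) *: v - inner (G x) w (v *m phi x) *: u.
Proof.
move=> Ux.
have Ccst (a : 'rV[R]_m) : smooth U (fun=> a) by move=> k; exact: Ck_cst.
have dc (a : 'rV[R]_m) y := @differentiable_cst R 'rV[R]_m _ a y.
have dxi := smooth_differentiable Cxi Ux.
have Cg a b : smooth U (fun y => gamma G y a b).
  by move=> k; exact: smooth_gamma.
have dg a b : differentiable (fun y => gamma G y a b) x.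
  exact: smooth_differentiable (Cg a b) Ux.
have di V W : smooth U V -> smooth U W ->
    differentiable (fun y => inner (G y) (V y) (W y)) x.
  move=> CV CW; apply: (@Ck_differentiable _ _ R 0 U) => //.
  exact: (@Ck_inner_along _ _ _ U U G id rG oU (smooth_id U) (fun _ => id)).
pose Z y := w *m phi y; have CZ : smooth U Z by exact: smooth_phi.
rewrite -[w *m phi x]/(Z x) -(ricci_identity rG u v Ux CZ).
(* The Sasakian identity for w phi, differentiated once more. Terms symmetric in [a] and [b], such
   as those with [gamma G x a b], cancel in the commutator. *)
have E a b : cov G (cov G Z ^~ b) x a =
    (cov G (fun y => gamma G y b w) x a *m phi x +
      inner (G x) a (gamma G x b w) *: xi x -
      inner (G x) (gamma G x b w) (xi x) *: a) +
    (inner (G x) (gamma G x a b) w + inner (G x) b (gamma G x a w)) *: xi x -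
    inner (G x) b w *: (a *m phi x) -
    ((inner (G x) (gamma G x a w) (xi x) - inner (G x) w (a *m phi x)) *: b +
      inner (G x) w (xi x) *: gamma G x a b).
  have EZ y : U y -> cov G Z y b = gamma G y b w *m phi y +
      (inner (G y) b w *: xi y - inner (G y) w (xi y) *: b).
    move=> Uy; rewrite -eta_inner//.
    by rewrite -(sasaki b (Ccst w) Uy) cov_cst addrC subrK.
  rewrite (cov_eq_on rG _ Ux EZ).
  have d1 := smooth_differentiable (smooth_phi (Cg b w)) Ux.
  have d2 := differentiable_scale (di _ _ (Ccst b) (Ccst w)) dxi.
  have d3 := differentiable_scale (di _ _ (Ccst w) Cxi) (dc b x).
  have d3' : differentiable (fun y => - (inner (G y) w (xi y) *: b)) x.
    exact: differentiableN d3.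
  rewrite (cov_add G a d1 (differentiable_add d2 d3')) (cov_add G a d2 d3').
  rewrite (cov_opp G a d3) (cov_scale G a (di _ _ (Ccst b) (Ccst w)) dxi).
  rewrite (cov_scale G a (di _ _ (Ccst w) Cxi) (dc b x)).
  rewrite !(dd_inner rG)// !cov_cst cov_xi// innerNr.
  have := sasaki a (Cg b w) Ux; rewrite eta_inner// => /eqP.
  rewrite subr_eq => /eqP ->.
  by apply/rowP => i; rewrite !mxE; ring.
rewrite !E /rm mulmxBl (gamma_sym rG v u Ux).
rewrite (symG (gamma G x u v) w Ux) (symG v (gamma G x u w) Ux).
rewrite (symG u (gamma G x v w) Ux).
set A := cov _ _ _ _ *m _; set B := cov _ _ _ _ *m _.
by apply/rowP => i; rewrite !mxE; ring.
Qed.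

(** An instance of [sasakian_curvature]; its hypothesis [QJ] is [rm_phi] paired with a vector in the
    image of [phi]. *)
Lemma sasakian_rm x u v : U x -> inner (G x) u (xi x) = 0 ->
  inner (G x) v (xi x) = 0 -> inner (G x) u v = 0 ->
  inner (G x) (rm G x u v v) u =
  (c + 3) / 4 * (inner (G x) u u * inner (G x) v v) +
  3 * (c - 1) / 4 * inner (G x) u (v *m phi x) ^+ 2.
Proof.
move=> Ux.
have skew a b : inner (G x) a (b *m phi x) = - inner (G x) (a *m phi x) b.
  by rewrite phi_skew// symG.
have PP a : inner (G x) a (xi x) = 0 -> a *m phi x *m phi x = - a.
  by move=> a0; rewrite phi2// eta_inner// a0 scale0r addr0.
have iso a b : inner (G x) b (xi x) = 0 ->
    inner (G x) (a *m phi x) (b *m phi x) = inner (G x) a b.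
  by move=> b0; rewrite compat// (eta_inner b)// b0 mulr0 subr0.
have QZ k a b d e : inner (G x) (rm G x (k *: a) b d) e =
    k * inner (G x) (rm G x a b d) e.
  have -> : k *: a = k *: a + 0 by rewrite addr0.
  rewrite (rm_linear rG)// innerDl innerZl.
  have := rm_linear rG 1 0 0 b d Ux; rewrite scaler0 addr0 scale1r.
  by move/eqP; rewrite -subr_eq subrr eq_sym => /eqP->; rewrite inner0l addr0.
apply: (@sasakian_curvature R _ (inner (G x)) (fun a => a *m phi x) (xi x)
  (fun a b d e => inner (G x) (rm G x a b d) e) c).
- by move=> *; exact: innerDl.
- by move=> *; exact: innerZl.
- by move=> *; exact: symG.
- by move=> *; exact: mulmxDl.
- by move=> *; exact: mulNmx.
- exact: phi_xi.
- exact: skew.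
- exact: PP.
- by move=> a a' b d e; rewrite -{1}[a]scale1r (rm_linear rG)// scale1r innerDl.
- exact: QZ.
- by move=> a b d e; rewrite rm_sym innerNl.
- by move=> a b d e; exact: (rm_skew rG).
- by move=> a b d e; rewrite -!innerDl (rm_bianchi rG)// inner0l.
- move=> a b d e e0; rewrite rm_phi//; move: (rm G x a b d) => r.
  by rewrite !(innerDl, innerNl) !innerZl !iso.
- move=> a a0; have [->|nza] := eqVneq a 0.
    by rewrite inner0r inner0l expr0n mulr0.
  have s0 := riemannian_pos rG Ux nza.
  set s := inner (G x) a a in s0 *.
  (* [phi_sectional] speaks of unit vectors only. With [k] the length of [a], both sides of [Qc]
     scale by the fourth power of [k]. *)
  pose k := Num.sqrt s; have k0 : 0 < k by rewrite sqrtr_gt0.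
  have kk : k * k = s by rewrite -expr2 sqr_sqrtr// ltW.
  have aE : a = k *: (k^-1 *: a) by rewrite scalerA divff ?scale1r// gt_eqF.
  set p := k^-1 *: a in aE.
  have sp : inner (G x) p p = 1.
    by rewrite /p innerZl innerZr -/s -kk mulrA -invfM mulVf// mulf_neq0//
      gt_eqF.
  have p0 : inner (G x) p (xi x) = 0 by rewrite /p innerZl a0 mulr0.
  have pp : inner (G x) p (p *m phi x) = 0.
    by have := phi_skew p p Ux; lra.
  have := phi_sectional Ux sp p0.
  rewrite /sectional riemannE iso// sp pp mulr1 expr0n subr0 divr1 => Ec.
  rewrite -kk {1 2 3 4}aE -scalemxAl QZ innerZr (rm_skew rG)// innerZr.
  rewrite (rm_sym G x p) innerNl QZ -Ec.
  by rewrite [in RHS](rm_skew rG)// (rm_sym G x p) innerNl; ring.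
Qed.

End SasakianChart.

(** * Orthonormal frames *)

Section Frames.
Context {R : realType}.

(** The rows of [P] are the vectors; [P] may be rectangular, so that families can be stacked with
    [col_mx]. *)
Definition orthonormal {p m} (A : 'M[R]_m) (P : 'M[R]_(p, m)) : Prop :=
  P *m A *m P^T = 1%:M.

Lemma gramE p q m (A : 'M[R]_m) (P : 'M[R]_(p, m)) (P' : 'M[R]_(q, m)) i j :
  (P *m A *m P'^T) i j = inner A (row i P) (row j P').
Proof.
rewrite /inner -row_mul !mxE; apply: eq_bigr => k _.
by rewrite !mxE.
Qed.

Lemma orthonormalP p m (A : 'M[R]_m) (P : 'M[R]_(p, m)) : orthonormal A P <->
  forall i j, inner A (row i P) (row j P) = (i == j)%:R.
Proof.
split=> [oP i j|oP]; first by rewrite -gramE oP mxE.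
by apply/matrixP => i j; rewrite gramE oP mxE.
Qed.

Lemma orthonormal_col_mx p q m (A : 'M[R]_m) (P : 'M[R]_(p, m))
  (P' : 'M[R]_(q, m)) :
  orthonormal A P -> orthonormal A P' ->
  (forall i j, inner A (row i P) (row j P') = 0) ->
  (forall i j, inner A (row i P') (row j P) = 0) ->
  orthonormal A (col_mx P P').
Proof.
move=> oP oP' PP' P'P; rewrite /orthonormal mul_col_mx tr_col_mx mul_col_row.
rewrite oP oP' scalar_mx_block; congr block_mx; apply/matrixP => i j.
  by rewrite gramE PP' mxE.
by rewrite gramE P'P mxE.
Qed.

(** Fewer than [m] vectors leave a nonzero kernel of [A *m P^T], that is, a nonzero vector
    orthogonal to them all; normalize it and add it. *)
Lemma orthonormal_basis m (A : 'M[R]_m) :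
  (forall u v, inner A u v = inner A v u) ->
  (forall u, u != 0 -> 0 < inner A u u) -> exists P : 'M[R]_m, orthonormal A P.
Proof.
move=> symA posA.
suff H k : (k <= m)%N -> exists P : 'M[R]_(k, m), orthonormal A P by exact: H.
elim: k => [|k IHk] km; first by exists 0; apply/matrixP => -[].
have [P oP] := IHk (ltnW km).
have : kermx (A *m P^T) != 0.
  rewrite -mxrank_eq0 mxrank_ker -lt0n subn_gt0.
  exact: leq_ltn_trans (rank_leq_col _) km.
case/rowV0Pn => w /sub_kermxP wP w0.
have s0 := posA _ w0; set s := inner A w w in s0.
have k0 : 0 < Num.sqrt s by rewrite sqrtr_gt0.
pose p := (Num.sqrt s)^-1 *: w.
have pP i : inner A p (row i P) = 0.
  have := gramE A w P 0 i; rewrite row_id -mulmxA wP mxE => wPi.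
  by rewrite /p innerZl -wPi mulr0.
exists (col_mx p P); apply: (@orthonormal_col_mx 1 k m A p P) => //.
- apply/orthonormalP => i j; rewrite !ord1 eqxx row_id /p innerZl innerZr -/s.
  rewrite mulrA -invfM -expr2 sqr_sqrtr ?mulVf//; first by rewrite gt_eqF.
  exact: ltW.
- by move=> i j; rewrite !ord1 row_id.
- by move=> i j; rewrite !ord1 row_id symA.
Qed.

Section Square.
Variables (m : nat) (A P : 'M[R]_m).
Hypothesis oP : orthonormal A P.

Lemma orthonormal_inv : A *m P^T *m P = 1%:M.
Proof. by apply: mulmx1C; rewrite mulmxA. Qed.

Lemma orthonormal_expand w : w = \sum_k inner A w (row k P) *: row k P.
Proof.
rewrite -{1}[w]mulmx1 -orthonormal_inv !mulmxA mulmx_sum_row.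
by apply: eq_bigr => k _; rewrite gramE row_id.
Qed.

(** The frame factors the inverse metric as [P^T *m P], so the contraction with [invmx A] becomes a
    sum over the frame. *)
Lemma mtrace_orthonormal (W : lmodType R) (T : 'rV[R]_m -> 'rV[R]_m -> W) :
  bil T -> mtrace A T = \sum_k T (row k P) (row k P).
Proof.
move=> bT; rewrite /mtrace.
have -> : invmx A = P^T *m P.
  have uA : A \in unitmx.
    by have /mulmx1_unit[] := etrans (mulmxA _ _ _) orthonormal_inv.
  by rewrite -[RHS](mulKmx uA) (mulmxA A) orthonormal_inv mulmx1.
under eq_bigr do under eq_bigr do rewrite mxE scaler_suml.
under eq_bigr do rewrite exchange_big.
rewrite exchange_big; apply: eq_bigr => k _.
rewrite (bil_expand bT); apply: eq_bigr => i _; apply: eq_bigr => j _.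
by rewrite !mxE.
Qed.

Lemma parseval w : inner A w w = \sum_k inner A w (row k P) ^+ 2.
Proof.
rewrite {2}(orthonormal_expand w) inner_sumr; apply: eq_bigr => k _.
by rewrite innerZr -expr2.
Qed.

End Square.

(** For frames stacked from blocks: n + n + 1 and [n.*2.+1] are equal but not convertible. *)
Lemma parseval_cast p m (A : 'M[R]_m) (P : 'M[R]_(p, m)) w : p = m ->
  orthonormal A P -> inner A w w = \sum_k inner A w (row k P) ^+ 2.
Proof.
by move=> pm; move: A P w; case: m / pm => A P w oP; exact: (parseval oP).
Qed.

End Frames.

(** * Isometric immersions *)

Section IsometricImmersion.
Context {R : realType} {n m : nat}.
Variables (Uf : set 'rV[R]_n) (U : set 'rV[R]_m).
Variables (G : 'rV[R]_n -> 'M[R]_n) (H : 'rV[R]_m -> 'M[R]_m).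
Variable f : 'rV[R]_n -> 'rV[R]_m.
Hypotheses (rG : riemannian Uf G) (rH : riemannian U H) (Cf : smooth Uf f).
Hypothesis fU : forall x, Uf x -> U (f x).
Hypothesis isoG : forall x u v, Uf x ->
  inner (G x) u v = inner (H (f x)) (dd f x u) (dd f x v).

Let oUf := riemannian_open rG.
Let oU := riemannian_open rH.
Let symH := riemannian_sym rH.

Definition tau x : 'rV[R]_m := mtrace (G x) (nab G H f x).

Lemma tensionE : tension G H f = tau.
Proof.
apply/funext => x; rewrite /tension /tau; congr mtrace.
by apply/funext => u; apply/funext => v; rewrite nabE.
Qed.

Let ob x (Ux : Uf x) := orthonormal_basis
  (fun u v => riemannian_sym rG u v Ux)
  (fun u => @riemannian_pos _ _ _ _ rG x u Ux).

Lemma mtrace_const0 (W : lmodType R) (A : 'M[R]_n) :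
  mtrace A (fun _ _ => 0 : W) = 0.
Proof.
by rewrite /mtrace big1// => i _; rewrite big1// => j _; rewrite scaler0.
Qed.

Lemma tau_bil x : Uf x -> bil (nab G H f x).
Proof. exact: (nab_bil rH oUf Cf fU). Qed.

Lemma tau_normal x w : Uf x -> inner (H (f x)) (tau x) (dd f x w) = 0.
Proof.
move=> Ux; have [P oP] := ob Ux.
rewrite /tau (mtrace_orthonormal oP (tau_bil Ux)) inner_suml big1// => k _.
exact: (nab_normal rH oUf Cf fU rG isoG).
Qed.

Lemma normal_partE x a w : Uf x ->
  (forall u, inner (H (f x)) a (dd f x u) = 0) ->
  normal_part G H f x (a + dd f x w) = a.
Proof.
move=> Ux a0; have [P oP] := ob Ux; have df := smooth_differentiable Cf Ux.
rewrite /normal_part ddE (mtrace_orthonormal oP); last first.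
  split=> k u u' v; rewrite ddDl// ddZl//.
    by rewrite innerDr innerZr scalerDl scalerA.
  by rewrite scalerDr !scalerA mulrC.
have E : dd f x w = \sum_k inner (G x) w (row k P) *: dd f x (row k P).
  rewrite {1}(orthonormal_expand oP w) -ddE derive_suml//.
rewrite {1}E [X in _ - X](_ : _ =
  \sum_k inner (G x) w (row k P) *: dd f x (row k P)) ?addrK//.
by apply: eq_bigr => k _; rewrite innerDl a0 add0r isoG.
Qed.

(** [nab] is normal and differs from the ambient derivative by a tangent vector, so it is the normal
    part. *)
Lemma mean_curvatureE x : Uf x -> mean_curvature G H f x = n%:R^-1 *: tau x.
Proof.
move=> Ux; rewrite /mean_curvature /tau; congr (_ *: mtrace _ _).
apply/funext => u; apply/funext => v; rewrite /second_ff covaE ddE.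
have -> : cova H f (dd f ^~ v) x u = nab G H f x u v + dd f x (gamma G x u v).
  by rewrite /nab subrK.
by apply: normal_partE => // w; exact: (nab_normal rH oUf Cf fU rG isoG).
Qed.

Lemma Ck_df k V : Ck k Uf V -> Ck k Uf (fun x => dd f x (V x)).
Proof.
move=> CV; apply: (@Ck_ext _ _ _ _ _ (fun x =>
  \sum_i V x 0 i *: dd f x (basis_vec i))) => //.
  by move=> y Uy; rewrite -dd_basis//; exact: smooth_differentiable Cf Uy.
apply: Ck_sum => // i _; apply: Ck_scale => //; first exact: Ck_entry.
by apply: Ck_dd; exact: Cf.
Qed.

Lemma smooth_tau : smooth Uf tau.
Proof.
move=> k; apply: Ck_sum => // i _; apply: Ck_sum => // j _.
apply: Ck_scale => //.
  apply: Ck_entry => //; apply: Ck_invmx => //; first exact: metric_unitmx rG.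
  exact: (riemannian_smooth rG k).
apply: Ck_sub => //.
  exact: (smooth_cova rH oUf Cf fU (basis_vec i)
    (smooth_dd (basis_vec j) Cf) k).
by apply: Ck_df; exact: (smooth_gamma rG).
Qed.

Lemma cova_eq_on V W x u : Uf x -> (forall y, Uf y -> V y = W y) ->
  cova H f V x u = cova H f W x u.
Proof. by move=> Ux VW; rewrite /cova (dd_eq_on _ oUf Ux VW) VW. Qed.

Lemma cova0 x u : cova H f (fun=> 0) x u = 0.
Proof. by rewrite /cova dd_cst (bil0r (gamma_bil H _)) addr0. Qed.

Lemma bitensionE x : bitension G H f x =
  mtrace (G x) (fun u v => cova H f (cova H f tau ^~ v) x u -
                           cova H f tau x (gamma G x u v)) -
  mtrace (G x) (fun u v => rm H (f x) (dd f x u) (tau x) (dd f x v)).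
Proof.
rewrite /bitension /rough_laplacian opprK tensionE ddE; congr (_ - _);
  congr mtrace.
  apply/funext => u; apply/funext => v; rewrite !covaE covD_cst;
    congr (cova H f _ x u - _).
  by apply/funext => y; rewrite covaE.
by apply/funext => u; apply/funext => v; rewrite riemannE.
Qed.

Lemma rm0r y u w : U y -> rm H y u 0 w = 0.
Proof.
move=> Uy; rewrite rm_sym; have := rm_linear rH 1 0 0 u w Uy.
rewrite scaler0 addr0 scale1r => /eqP; rewrite -subr_eq subrr eq_sym => /eqP->.
exact: oppr0.
Qed.

Lemma harmonic_biharmonic x : (forall y, Uf y -> tau y = 0) -> Uf x ->
  bitension G H f x = 0.
Proof.
move=> tau0 Ux; rewrite bitensionE.
have c0 y u : Uf y -> cova H f tau y u = 0.
  by move=> Uy; rewrite (cova_eq_on u Uy tau0) cova0.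
have -> : (fun u v => cova H f (cova H f tau ^~ v) x u -
    cova H f tau x (gamma G x u v)) = (fun _ _ => 0).
  apply/funext => u; apply/funext => v; rewrite c0// subr0.
  by rewrite (cova_eq_on u Ux (fun y => c0 y v)) cova0.
have -> : (fun u v => rm H (f x) (dd f x u) (tau x) (dd f x v)) =
    (fun _ _ => 0).
  by apply/funext => u; apply/funext => v; rewrite tau0// rm0r//; exact: fU.
by rewrite !mtrace_const0 subrr.
Qed.

(** Allows the rough Laplacian in [bitensionE] to be computed on an orthonormal frame. *)
Lemma hessian_bil V x : smooth Uf V -> Uf x ->
  bil (fun u v =>
    cova H f (cova H f V ^~ v) x u - cova H f V x (gamma G x u v)).
Proof.
move=> CV Ux; have dV := smooth_differentiable CV Ux.
have dc v := smooth_differentiable (smooth_cova rH oUf Cf fU v CV) Ux.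
split=> a u u' v.
  rewrite (covaDl H Cf _ _ Ux (dc v)) (covaZl H Cf _ _ Ux (dc v)).
  rewrite (gamma_bil G x).1 (covaDl H Cf _ _ Ux dV) (covaZl H Cf _ _ Ux dV).
  by rewrite scalerBr opprD addrACA.
rewrite (gamma_bil G x).2 (covaDl H Cf _ _ Ux dV) (covaZl H Cf _ _ Ux dV).
have -> : cova H f (cova H f V ^~ (a *: u' + v)) x u =
    cova H f (fun y => a *: cova H f V y u' + cova H f V y v) x u.
  apply: cova_eq_on => // y Uy; have dVy := smooth_differentiable CV Uy.
  by rewrite (covaDl H Cf _ _ Uy dVy) (covaZl H Cf _ _ Uy dVy).
have da := @differentiable_cst R 'rV[R]_n R a x.
have ds := differentiable_scale da (dc u').
rewrite (cova_add H f u ds (dc v)).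
have -> : cova H f (fun y => a *: cova H f V y u') x u =
    a *: cova H f (cova H f V ^~ u') x u.
  rewrite /cova (dd_scale u da (dc u')) dd_cst scale0r add0r.
  by rewrite (bilZr (gamma_bil H _)) scalerDr.
by rewrite scalerBr opprD addrACA.
Qed.

(** First and second derivative tests for |V|^2; its derivatives along [u] are twice the expressions
    in the conclusion. *)
Lemma max_principle V (D : set 'rV[R]_n) x u : smooth Uf V -> open D ->
  D `<=` Uf -> D x -> (forall y, D y -> inner (H (f y)) (V y) (V y) <=
                                       inner (H (f x)) (V x) (V x)) ->
  inner (H (f x)) (cova H f V x u) (V x) = 0 /\
  inner (H (f x)) (cova H f (cova H f V ^~ u) x u) (V x) +
    inner (H (f x)) (cova H f V x u) (cova H f V x u) <= 0.
Proof.
move=> CV oD DUf Dx Fmax; pose F y := inner (H (f y)) (V y) (V y).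
have Ux := DUf x Dx.
have CF k : Ck k Uf F by exact: (Ck_inner_along rH oUf Cf fU (CV k) (CV k)).
have CFD : Ck 2 D F.
  have [dF dDF] := CF 2; split=> [y Dy|v]; first exact/dF/DUf.
  have [dF' cF'] := dDF v; split=> [y Dy|w y Dy]; first exact/dF'/DUf.
  exact/cF'/DUf.
have dF y a : Uf y -> dd F y a = 2 * inner (H (f y)) (cova H f V y a) (V y).
  move=> Uy; have dV := smooth_differentiable CV Uy.
  rewrite (dd_inner_along rH Cf fU a Uy dV dV) [inner _ (V y) _]symH//;
    last exact: fU.
  by ring.
have dV := smooth_differentiable CV Ux.
have dc := smooth_differentiable (smooth_cova rH oUf Cf fU u CV) Ux.
have h1 := derive_at_max u oD Dx (CkS CFD) Fmax.
have h2 := derive2_at_max u oD Dx CFD Fmax.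
rewrite -/F ddE in h1 h2.
split; first by have := dF x u Ux; rewrite h1 => /esym; lra.
move: h2; rewrite (dd_eq_on u oUf Ux (fun y => dF y u)).
have di : differentiable (fun y => inner (H (f y)) (cova H f V y u) (V y)) x.
  apply: (@Ck_differentiable _ _ R 0 Uf) => //.
  apply: (Ck_inner_along rH oUf Cf fU) => //.
  exact: (smooth_cova rH oUf Cf fU u CV 1).
rewrite (@dd_scale _ _ R (fun=> 2) _ x u (differentiable_cst _ _) di).
rewrite dd_cst scale0r add0r (dd_inner_along rH Cf fU u Ux dc dV).
rewrite -[_ *: _]/(2 * _); lra.
Qed.

End IsometricImmersion.

(** * Integral submanifolds of maximal dimension *)

Section Legendrian.
Context {R : realType} {n : nat}.
Notation m := n.*2.+1.
Variables (Uf : set 'rV[R]_n) (U : set 'rV[R]_m).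
Variables (G : 'rV[R]_n -> 'M[R]_n) (H phi : 'rV[R]_m -> 'M[R]_m).
Variables (f : 'rV[R]_n -> 'rV[R]_m) (xi : 'rV[R]_m -> 'rV[R]_m) (c : R).
Hypotheses (rG : riemannian Uf G) (rH : riemannian U H) (Cf : smooth Uf f).
Hypothesis fU : forall x, Uf x -> U (f x).
Hypothesis isoG : forall x u v, Uf x ->
  inner (G x) u v = inner (H (f x)) (dd f x u) (dd f x v).
Hypothesis Cxi : smooth U xi.
Hypothesis xi_unit : forall y, U y -> inner (H y) (xi y) (xi y) = 1.
Hypothesis phi_orth : forall y u, U y -> inner (H y) (u *m phi y) (xi y) = 0.
Hypothesis phi_skew : forall y u v, U y ->
  inner (H y) u (v *m phi y) = - inner (H y) v (u *m phi y).
Hypothesis phi_iso : forall y u v, U y -> inner (H y) v (xi y) = 0 ->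
  inner (H y) (u *m phi y) (v *m phi y) = inner (H y) u v.
Hypothesis cov_xi : forall y u, U y -> cov H xi y u = - (u *m phi y).
Hypothesis curvH : forall y u v, U y -> inner (H y) u (xi y) = 0 ->
  inner (H y) v (xi y) = 0 -> inner (H y) u v = 0 ->
  inner (H y) (rm H y u v v) u =
  (c + 3) / 4 * (inner (H y) u u * inner (H y) v v) +
  3 * (c - 1) / 4 * inner (H y) u (v *m phi y) ^+ 2.
Hypothesis horizontal : forall x u, Uf x ->
  inner (H (f x)) (dd f x u) (xi (f x)) = 0.

Let oUf := riemannian_open rG.
Let symH := riemannian_sym rH.

(** Differentiate <df v, xi> = 0 along [u] and use [cov_xi]. *)
Lemma legendrian_cova_xi x u v : Uf x ->
  inner (H (f x)) (cova H f (dd f ^~ v) x u) (xi (f x)) =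
  inner (H (f x)) (dd f x v) (dd f x u *m phi (f x)).
Proof.
move=> Ux; have df := smooth_differentiable Cf Ux.
have dfv := smooth_differentiable (smooth_dd v Cf) Ux.
have dxi := smooth_differentiable Cxi (fU Ux).
have dxf : differentiable (fun y => xi (f y)) x.
  exact: (differentiable_comp df dxi).
have := dd_inner_along rH Cf fU u Ux dfv dxf.
rewrite (@dd_eq_on _ _ R Uf _ (fun=> 0) x u oUf Ux (fun y =>
  horizontal v)) dd_cst.
have -> : cova H f (fun y => xi (f y)) x u = - (dd f x u *m phi (f x)).
  rewrite -cov_xi; last exact: fU.
  by congr (_ + _); exact: (dd_comp u df dxi).
by rewrite innerNr; lra.
Qed.

(** By [legendrian_cova_xi] this is symmetric in [u], [v], and by [phi_skew] it is skew. In other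
    words, d eta vanishes on the submanifold. *)
Lemma legendrian_phi x u v : Uf x ->
  inner (H (f x)) (dd f x v) (dd f x u *m phi (f x)) = 0.
Proof.
move=> Ux; have := legendrian_cova_xi u v Ux.
rewrite (cova_sym rH oUf Cf fU u v Ux) (legendrian_cova_xi v u Ux).
by rewrite phi_skew; [lra|exact: fU].
Qed.

Lemma legendrian_second_xi x u v : Uf x ->
  inner (H (f x)) (cova H f (dd f ^~ v) x u) (xi (f x)) = 0.
Proof. by move=> Ux; rewrite legendrian_cova_xi// legendrian_phi. Qed.

Let ob x (Ux : Uf x) := orthonormal_basis
  (fun u v => riemannian_sym rG u v Ux)
  (fun u => @riemannian_pos _ _ _ _ rG x u Ux).

Lemma tau_frame x (P : 'M[R]_n) : Uf x -> orthonormal (G x) P ->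
  tau G H f x = \sum_k nab G H f x (row k P) (row k P).
Proof.
move=> Ux oP.
by rewrite /tau (mtrace_orthonormal oP (tau_bil rG rH Cf fU Ux)).
Qed.

Lemma legendrian_tau_xi x : Uf x ->
  inner (H (f x)) (tau G H f x) (xi (f x)) = 0.
Proof.
move=> Ux; have [P oP] := ob Ux.
rewrite (tau_frame Ux oP) inner_suml big1// => k _.
by rewrite /nab innerBl horizontal// legendrian_second_xi// subrr.
Qed.

(* The vectors [df e_k], [phi (df e_k)] and [xi] form an orthonormal basis of
   the ambient tangent space, and [phi w] is orthogonal to the last two
   families. *)
Lemma legendrian_norm x (P : 'M[R]_n) w : Uf x -> orthonormal (G x) P ->
  (forall u, inner (H (f x)) w (dd f x u) = 0) ->
  inner (H (f x)) w (xi (f x)) = 0 ->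
  \sum_k inner (H (f x)) (dd f x (row k P)) (w *m phi (f x)) ^+ 2 =
  inner (H (f x)) w w.
Proof.
move=> Ux oP wn wxi; have Uy := fU Ux.
pose E : 'M[R]_(n, m) := \matrix_k dd f x (row k P).
have rE k : row k E = dd f x (row k P) by rewrite rowK.
have rEp k : row k (E *m phi (f x)) = dd f x (row k P) *m phi (f x).
  by rewrite row_mul rE.
have oE : orthonormal (H (f x)) E.
  by apply/orthonormalP => i j; rewrite !rE -isoG// (orthonormalP _ _).1.
have oEp : orthonormal (H (f x)) (E *m phi (f x)).
  apply/orthonormalP => i j; rewrite !rEp phi_iso// ?horizontal//.
  by rewrite -isoG// (orthonormalP _ _).1.
have oxi : orthonormal (H (f x)) (xi (f x)).
  by apply/orthonormalP => i j; rewrite !ord1 !row_id xi_unit.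
have oB : orthonormal (H (f x)) (col_mx (col_mx E (E *m phi (f x))) (xi (f x))).
  apply: orthonormal_col_mx => //.
  - apply: orthonormal_col_mx => // i j; rewrite rE rEp; last rewrite symH//.
      exact: legendrian_phi.
    exact: legendrian_phi.
  - move=> i j; rewrite ord1 row_id; case: (split_ordP i) => k ->.
      by rewrite rowKu rE horizontal.
    by rewrite rowKd rEp phi_orth.
  - move=> i j; rewrite symH// ord1 row_id; case: (split_ordP j) => k ->.
      by rewrite rowKu rE horizontal.
    by rewrite rowKd rEp phi_orth.
have dimE : (n + n + 1 = m)%N by rewrite addnn addn1.
have := parseval_cast (w *m phi (f x)) dimE oB.
rewrite phi_iso// => ->; rewrite big_split_ord big_ord1 rowKd row_id phi_orth//.
rewrite expr0n /= addr0 big_split_ord [X in _ = _ + X]big1 ?addr0 => [|k _].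
  by apply: eq_bigr => k _; rewrite !rowKu rE symH.
by rewrite rowKu rowKd rEp phi_iso// ?horizontal// wn expr0n.
Qed.

Lemma legendrian_max x (D : set 'rV[R]_n) :
  (n%:R + 3) * c + 3 * n%:R - 3 <= 0 -> open D -> D `<=` Uf -> D x ->
  (forall y, D y -> inner (H (f y)) (tau G H f y) (tau G H f y) <=
                    inner (H (f x)) (tau G H f x) (tau G H f x)) ->
  bitension G H f x = 0 -> tau G H f x = 0.
Proof.
move=> c_le oD DUf Dx Fmax; have Ux := DUf x Dx; have Uy := fU Ux.
have [P oP] := ob Ux; rewrite bitensionE.
have df := smooth_differentiable Cf Ux.
have Ct := smooth_tau rG rH Cf fU.
set t := tau G H f in Ct Fmax *.
have mp u := max_principle rG rH Cf fU u Ct oD DUf Dx Fmax.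
rewrite (mtrace_orthonormal oP (hessian_bil rG rH Cf fU Ct Ux)).
have rm_bil : bil (fun u v => rm H (f x) (dd f x u) (t x) (dd f x v)).
  split=> a u u' v; rewrite ddDl// ddZl//; first exact: (rm_linear rH).
  exact: (rm_linear3 rH).
rewrite (mtrace_orthonormal oP rm_bil).
move/(congr1 (fun w => inner (H (f x)) w (t x))).
rewrite inner0l innerBl !inner_suml.
have -> : \sum_k inner (H (f x)) (rm H (f x) (dd f x (row k P)) (t x)
    (dd f x (row k P))) (t x) =
    - ((n%:R + 3) * c + 3 * n%:R - 3) / 4 * inner (H (f x)) (t x) (t x).
  have tn u : inner (H (f x)) (t x) (dd f x u) = 0.
    exact: (tau_normal rG rH Cf fU isoG).
  have txi := legendrian_tau_xi Ux.
  under eq_bigr => k _.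
    (* [rm_skew] moves the tension to the third slot, at the price of the sign in the sum. *)
    rewrite (rm_skew rH)// curvH ?horizontal//; last by rewrite symH// tn.
    rewrite -isoG// (orthonormalP _ _).1// eqxx mul1r opprD -[- (3 * _ / _ *
      _)]mulNr.
    over.
  rewrite big_split /= sumr_const card_ord -mulr_sumr (legendrian_norm Ux oP)//.
  by rewrite -mulr_natl; field.
move=> Ebi.
have pos0 w : 0 <= inner (H (f x)) w w.
  have [->|w0] := eqVneq w 0; first by rewrite inner0l.
  exact: ltW (riemannian_pos rH Uy w0).
have Lle k : inner (H (f x)) (cova H f (cova H f t ^~ (row k P)) x (row k P) -
      cova H f t x (gamma G x (row k P) (row k P))) (t x) <=
    - inner (H (f x)) (cova H f t x (row k P)) (cova H f t x (row k P)).
  (* Coordinate lines need not be geodesics, but the correction is a first derivative of [t] paired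
     with [t], and this vanishes at the maximum in every direction. *)
  by rewrite innerBl (mp _).1 subr0; have := (mp (row k P)).2; lra.
have c0 k : cova H f t x (row k P) = 0.
  apply/eqP; apply: contraT => /(riemannian_pos rH Uy).
  suff -> : inner (H (f x)) (cova H f t x (row k P)) (cova H f t x (row k P)) =
    0.
    by rewrite ltxx.
  have : \sum_k inner (H (f x)) (cova H f t x (row k P))
    (cova H f t x (row k P)) <= 0.
    have := ler_sum (index_enum 'I_n) (fun k (_ : true) => Lle k).
    rewrite sumrN => /le_trans/(_ (lexx _)) Lsum.
    have := pos0 (t x); move: Lsum Ebi c_le.
    set A := \sum_k _; set B := \sum_k _; set T := inner _ _ _.
    set q := (_ + _ - _); move=> h1 h2 h3 h4.
    have : 0 <= - q * T by rewrite mulr_ge0// oppr_ge0.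
    lra.
  rewrite le_eqVlt ltNge sumr_ge0// orbF psumr_eq0// => /allP/(_ k).
  by rewrite mem_index_enum => /(_ isT)/eqP.
have tn u y : Uf y -> inner (H (f y)) (t y) (dd f y u) = 0.
  by move=> Uy'; exact: (tau_normal rG rH Cf fU isoG).
have nk k : inner (H (f x)) (t x) (nab G H f x (row k P) (row k P)) = 0.
  have dt := smooth_differentiable Ct Ux.
  have dfk := smooth_differentiable (smooth_dd (row k P) Cf) Ux.
  have := dd_inner_along rH Cf fU (row k P) Ux dt dfk.
  rewrite (@dd_eq_on _ _ R Uf _ (fun=> 0) x _ oUf Ux (tn (row k P))) dd_cst.
  by rewrite c0 inner0l add0r /nab innerBr tn// subr0.
apply/eqP; apply: contraT => /(riemannian_pos rH Uy).
(* Only the second factor of <t, t> is expanded over the frame; each summand is zero by [nk]. *)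
by rewrite {2}/t (tau_frame Ux oP) inner_sumr big1 ?ltxx.
Qed.

End Legendrian.

(** * Invariance under isometries *)

Section Isometries.
Context {R : realType}.

Lemma Ck_subset (V W : normedModType R) k (U D : set V) (f : V -> W) :
  D `<=` U -> Ck k U f -> Ck k D f.
Proof.
move=> DU; elim: k f => [|k IHk] f /=; first by move=> cf x /DU; exact: cf.
by move=> [df Df]; split=> [x /DU|v]; [exact: df|exact/IHk/Df].
Qed.

Lemma riemannian_subset m (U D : set 'rV[R]_m) G : open D -> D `<=` U ->
  riemannian U G -> riemannian D G.
Proof.
move=> oD DU [oU CG symG posG]; split=> //.
- by move=> k; exact: Ck_subset (CG k).
- by move=> y u v /DU; exact: symG.
- by move=> y u /DU; exact: posG.
Qed.

Lemma smooth_comp n m p (Uf : set 'rV[R]_n) (U : set 'rV[R]_m)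
    (f : 'rV[R]_n -> 'rV[R]_m) (th : 'rV[R]_m -> 'rV[R]_p) : open Uf ->
  (forall y, Uf y -> U (f y)) -> smooth Uf f -> smooth U th ->
  smooth Uf (fun y => th (f y)).
Proof. by move=> oUf fU Cf Cth k; exact: Ck_comp fU (Cf k) (Cth k). Qed.

Lemma nab_eq_on n m (Uf : set 'rV[R]_n) G (H : 'rV[R]_m -> 'M[R]_m)
    (f f' : 'rV[R]_n -> 'rV[R]_m) x u v : open Uf -> Uf x ->
  (forall y, Uf y -> f y = f' y) -> nab G H f x u v = nab G H f' x u v.
Proof.
move=> oUf Ux ff'.
have dff' w y : Uf y -> dd f y w = dd f' y w.
  by move=> Uy; exact: dd_eq_on oUf Uy ff'.
by rewrite /nab /cova ff'// !dff'// (dd_eq_on u oUf Ux (dff' v)).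
Qed.

Section Isometry.
Variables (m : nat) (U U' : set 'rV[R]_m) (H K : 'rV[R]_m -> 'M[R]_m).
Variable th : 'rV[R]_m -> 'rV[R]_m.
Hypotheses (rH : riemannian U H) (rK : riemannian U' K) (Cth : smooth U th).
Hypothesis thU : forall y, U y -> U' (th y).
Hypothesis iso : forall y u v, U y ->
  inner (H y) u v = inner (K (th y)) (dd th y u) (dd th y v).

(** Preserving a positive definite form makes the differential injective, hence onto in equal
    dimensions. *)
Lemma isometry_surj y z : U y -> exists w, dd th y w = z.
Proof.
move=> Uy; have dth := smooth_differentiable Cth Uy.
pose J : 'M[R]_m := \matrix_i dd th y (basis_vec i).
have thJ w : dd th y w = w *m J.
  rewrite (dd_basis w dth) mulmx_sum_row; apply: eq_bigr => i _.
  by rewrite rowK.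
have uJ : J \in unitmx.
  rewrite -row_free_unit -kermx_eq0; apply/rowV0P => w /sub_kermxP wJ.
  apply/eqP; apply: contraT => /(riemannian_pos rH Uy).
  by rewrite iso// !thJ wJ inner0l ltxx.
by exists (z *m invmx J); rewrite thJ mulmxKV.
Qed.

(** It is normal to the image of the differential, which by [isometry_surj] is the whole space. *)
Lemma isometry_nab y u v : U y -> nab H K th y u v = 0.
Proof.
move=> Uy; apply: inner_eq0; first by move=> w;
  exact: (riemannian_pos rK (thU Uy)).
move=> z; have [w <-] := isometry_surj z Uy.
exact: (nab_normal rK (riemannian_open rH) Cth thU rH iso).
Qed.

End Isometry.

Section TensionInvariance.
Variables (n m : nat) (E Uf : set 'rV[R]_n) (U U' : set 'rV[R]_m).
Variables (G' G : 'rV[R]_n -> 'M[R]_n) (H K : 'rV[R]_m -> 'M[R]_m).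
Variables (f f' : 'rV[R]_n -> 'rV[R]_m).
Variables (ka : 'rV[R]_n -> 'rV[R]_n) (th : 'rV[R]_m -> 'rV[R]_m).
Hypotheses (rG' : riemannian E G') (rG : riemannian Uf G).
Hypotheses (rH : riemannian U H) (rK : riemannian U' K).
Hypotheses (Cf : smooth Uf f) (Cka : smooth E ka) (Cth : smooth U th).
Hypothesis fU : forall x, Uf x -> U (f x).
Hypothesis kaU : forall x, E x -> Uf (ka x).
Hypothesis thU : forall y, U y -> U' (th y).
Hypothesis iso_ka : forall x u v, E x ->
  inner (G' x) u v = inner (G (ka x)) (dd ka x u) (dd ka x v).
Hypothesis iso_th : forall y u v, U y ->
  inner (H y) u v = inner (K (th y)) (dd th y u) (dd th y v).
Hypothesis f'E : forall x, E x -> f' x = th (f (ka x)).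

Let oE := riemannian_open rG'.
Let oUf := riemannian_open rG.
Let oU := riemannian_open rH.

(** [nab_comp] is used for [th] after [f] and [ka], then for [f] after [ka]; each time the term of
    the isometry drops out. *)
Lemma nab_change x u v : E x ->
  nab G' K f' x u v =
  dd th (f (ka x)) (nab G H f (ka x) (dd ka x u) (dd ka x v)).
Proof.
move=> Ex; have fkaU y : E y -> U (f (ka y)) by move=> Ey; exact/fU/kaU.
have Cfka := smooth_comp oE kaU Cka Cf.
rewrite (nab_eq_on _ _ _ _ oE Ex f'E).
rewrite (nab_comp G' H K u v oE oU Cfka Cth fkaU Ex).
rewrite (isometry_nab rH rK Cth thU iso_th)// ?addr0; last exact: fkaU.
rewrite (nab_comp G' G H u v oE oUf Cka Cf kaU Ex).
rewrite (isometry_nab rG' rG Cka kaU iso_ka)//.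
have df := smooth_differentiable Cf (kaU Ex).
by have := ddZl 0 0 df; rewrite !scale0r => ->; rewrite add0r.
Qed.

(** The differential of [ka] carries an orthonormal frame to an orthonormal frame, so the tension
    transforms by that of [th], which preserves norms. *)
Lemma tau_norm_change x : E x ->
  inner (K (f' x)) (tau G' K f' x) (tau G' K f' x) =
  inner (H (f (ka x))) (tau G H f (ka x)) (tau G H f (ka x)).
Proof.
move=> Ex; have Ux := kaU Ex; have Uy := fU Ux.
have [P oP] := orthonormal_basis (fun u v => riemannian_sym rG' u v Ex)
  (fun u => @riemannian_pos _ _ _ _ rG' x u Ex).
pose Q : 'M[R]_n := \matrix_k dd ka x (row k P).
have oQ : orthonormal (G (ka x)) Q.
  by apply/orthonormalP => i j; rewrite !rowK -iso_ka// (orthonormalP _ _).1.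
have dth := smooth_differentiable Cth Uy.
have dka := smooth_differentiable Cka Ex.
have nb := nab_bil rH oUf Cf fU G Ux.
have th0 : dd th (f (ka x)) 0 = 0 by have := ddZl 0 0 dth; rewrite !scale0r.
have -> : tau G' K f' x = dd th (f (ka x)) (tau G H f (ka x)).
  rewrite /tau (mtrace_orthonormal oQ nb) (mtrace_orthonormal oP); last first.
    split=> a u u' w; rewrite !nab_change//.
      rewrite (ddDl (a *: u) u' dka) (ddZl a u dka) nb.1.
      by rewrite [LHS](ddDl _ _ dth) (ddZl a _ dth).
    rewrite (ddDl (a *: u') w dka) (ddZl a u' dka) nb.2.
    by rewrite [LHS](ddDl _ _ dth) (ddZl a _ dth).
  rewrite (big_morph (dd th (f (ka x))) (fun u v => ddDl u v dth) th0).
  by apply: eq_bigr => k _; rewrite nab_change// !rowK.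
by rewrite f'E// -iso_th.
Qed.

End TensionInvariance.

End Isometries.

(** * Manifolds *)

(* [point] and [coord] of MathComp-Analysis and MathComp shadow those of
   [manifold]. *)
Import Defs.

Section Charts.
Context {R : realType}.

Lemma riemannian_chart m (N : manifold R m) (h : metric N) b :
  riemannian (img b) (h b).
Proof.
split.
- exact: img_open.
- exact: met_smooth.
- by move=> y u v Uy; exact: met_sym.
- by move=> y u Uy; exact: met_pos.
Qed.

Lemma point_coord m (N : manifold R m) b y : img b y ->
  dom N b (point N b y) /\ coord N b (point N b y) = y.
Proof. by case=> p pb <-; rewrite coordK. Qed.

Lemma open_local_dom n m (M : manifold R n) (N : manifold R m)
    (psi : M -> N) a b :
  continuous psi -> open (local_dom psi a b).
Proof.
move=> cpsi; rewrite openE => x [ax bx]; apply: filterI.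
  by apply: open_nbhs_nbhs; split => //; exact: img_open.
have cp : {for x, continuous (psi \o point M a)}.
  by apply: continuous_comp; [exact: point_continuous|exact: cpsi].
exact: cp (near_in (dom_open b) bx).
Qed.

(** * The squared norm of the tension field as a function on the manifold *)

Section GlobalTension.
Variables (n m : nat) (M : manifold R n) (N : manifold R m).
Variables (g : metric M) (h : metric N) (psi : M -> N).
Hypotheses (Cpsi : smooth_map psi) (g_induced : induced_metric g h psi).

Let f a b := local_map psi a b.
Let D a b := local_dom psi a b.

Lemma open_dom a b : open (D a b).
Proof. by apply: open_local_dom; have [] := Cpsi. Qed.

Lemma smooth_local_map a b : smooth (D a b) (f a b).
Proof. by have [_] := Cpsi; apply. Qed.

Lemma local_map_img a b x : D a b x -> img b (f a b x).
Proof. by move=> [_ bx]; exists (psi (point M a x)). Qed.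

Lemma riemannian_local_dom a b : riemannian (D a b) (g a).
Proof.
by apply: riemannian_subset (riemannian_chart g a);
  [exact: open_dom|move=> x []].
Qed.

Lemma local_map_isometric a b x u v : D a b x ->
  inner (g a x) u v = inner (h b (f a b x)) (dd (f a b) x u) (dd (f a b) x v).
Proof. by move=> Dx; rewrite -ddE; exact: g_induced. Qed.

Definition tau_sq a b x : R :=
  inner (h b (f a b x)) (tau (g a) (h b) (f a b) x) (tau (g a) (h b) (f a b) x).

Lemma smooth_tau_sq a b k : Ck k (D a b) (tau_sq a b).
Proof.
have Ct := smooth_tau (riemannian_local_dom a b) (riemannian_chart h b)
  (@smooth_local_map a b) (@local_map_img a b).
exact: (Ck_inner_along (riemannian_chart h b) (@open_dom a b)
  (@smooth_local_map a b) (@local_map_img a b) (Ct k) (Ct k)).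
Qed.

Lemma tau_sq_chart a a' b b' p : dom M a p -> dom M a' p ->
  dom N b (psi p) -> dom N b' (psi p) ->
  tau_sq a' b' (coord M a' p) = tau_sq a b (coord M a p).
Proof.
move=> ap a'p bp b'p.
(* [local_dom] of the identity is the domain of a transition map; [E], [Uf] and [U1] are the sets
   where both source and target charts overlap. *)
pose E := (@local_dom _ _ _ M M id a' a `&` D a' b) `&` D a' b'.
pose Uf := D a b `&` D a b'.
pose U1 := @local_dom _ _ _ N N id b b'.
have oE : open E.
  apply: openI; last exact: open_dom.
  by apply: openI; [apply: open_local_dom => ?; exact: cvg_id|exact: open_dom].
have oUf : open Uf by apply: openI; exact: open_dom.
have oU1 : open U1 by apply: open_local_dom => ?; exact: cvg_id.
pose ka := coord M a \o point M a'; pose th := coord N b' \o point N b.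
have rG' : riemannian E (g a').
  by apply: riemannian_subset (riemannian_local_dom a' b') => // x [].
have rG : riemannian Uf (g a).
  by apply: riemannian_subset (riemannian_local_dom a b) => // x [].
have rH : riemannian U1 (h b).
  by apply: riemannian_subset (riemannian_chart h b) => // x [].
have Cf : smooth Uf (f a b).
  by move=> k; apply: Ck_subset (@smooth_local_map a b k) => x [].
have Cka : smooth E ka.
  move=> k; apply: Ck_subset (@transition_smooth _ _ M a' a k) =>
    x [[[a'x ax] _] _].
  have [a'q qx] := point_coord a'x.
  by exists (point M a' x).
have Cth : smooth U1 th.
  move=> k; apply: Ck_subset (@transition_smooth _ _ N b b' k) => y [b_y b'y].
  have [bq qy] := point_coord b_y.
  by exists (point N b y).
have fU x : Uf x -> U1 (f a b x).
  by move=> [[ax bx] [_ b'x]]; split;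
    [exact: local_map_img|rewrite /f /local_map /= coordK].
have kaK x : E x -> point M a (ka x) = point M a' x.
  by move=> [[[_ ax] _] _]; rewrite /ka /= coordK.
have kaU x : E x -> Uf (ka x).
  move=> Ex; have := Ex; move=> [[[_ ax] [_ bx]] [_ b'x]].
  have ika : img a (ka x) by exists (point M a' x).
  by split; split; rewrite ?kaK.
have thU y : U1 y -> img b' (th y).
  by move=> [_ b'y]; exists (point N b y).
have iso_ka x u v : E x ->
    inner (g a' x) u v = inner (g a (ka x)) (dd ka x u) (dd ka x v).
  move=> [[[a'x ax] _] _]; have [a'q qx] := point_coord a'x.
  rewrite -ddE; have := met_change g u v a'q ax.
  by rewrite /change qx => <-.
have iso_th y u v : U1 y ->
    inner (h b y) u v = inner (h b' (th y)) (dd th y u) (dd th y v).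
  move=> [b_y b'y]; have [bq qy] := point_coord b_y.
  rewrite -ddE; have := met_change h u v bq b'y.
  by rewrite /change qy => <-.
have f'E x : E x -> f a' b' x = th (f a b (ka x)).
  move=> Ex; rewrite /f /local_map /th /= kaK//.
  by move: Ex => [[_ [_ bx]] _]; rewrite coordK.
have Ep : E (coord M a' p).
  have a'i : img a' (coord M a' p) by exists p.
  by split; [split|]; split; rewrite // coordK.
have := tau_norm_change rG' rG rH (riemannian_chart h b') Cf Cka Cth fU kaU thU
  iso_ka iso_th f'E Ep.
by rewrite -/(tau_sq a' b' _) -/(tau_sq a b _) {1}/ka /= coordK.
Qed.

Definition some_chart k (P : manifold R k) (p : P) : chart P :=
  projT1 (cid (dom_cover p)).

Lemma some_chartP k (P : manifold R k) (p : P) : dom P (some_chart p) p.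
Proof. exact: projT2 (cid (dom_cover p)). Qed.

Definition tension_sq (p : M) : R :=
  tau_sq (some_chart p) (some_chart (psi p)) (coord M (some_chart p) p).

Lemma tension_sqE a b p : dom M a p -> dom N b (psi p) ->
  tension_sq p = tau_sq a b (coord M a p).
Proof. by move=> ap bp; apply: tau_sq_chart => //; exact: some_chartP. Qed.

(** The chosen charts may jump from point to point; by [tension_sqE] those of [p] can be kept fixed
    nearby. *)
Lemma tension_sq_continuous : continuous tension_sq.
Proof.
move=> p; set a := some_chart p; set b := some_chart (psi p).
have [ap bp] := (some_chartP p, some_chartP (psi p)).
have Dp : D a b (coord M a p).
  by split; [exists p|rewrite coordK].
have c1 : {for p, continuous (tau_sq a b \o coord M a)}.
  apply: continuous_comp; first exact: coord_continuous.
  exact: (@smooth_tau_sq a b 0).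
suff : tension_sq @ p --> tension_sq p by [].
rewrite [tension_sq p](tension_sqE ap bp); apply: cvg_trans c1.
apply: near_eq_cvg; near=> q; rewrite /= -(@tension_sqE a b)//.
- by near: q; exact: near_in (dom_open a) ap.
- near: q; have [cpsi _] := Cpsi.
  exact: cpsi (near_in (dom_open b) bp).
Unshelve. all: by end_near. Qed.

End GlobalTension.

End Charts.

(** * From the global contact structure to the hypotheses in a chart *)

Section SasakianManifold.
Context {R : realType} {n : nat}.
Variables (N : manifold R n.*2.+1) (S : contact_metric N) (c : R).
Hypothesis space_form : sasakian_space_form S c.
Variable b : chart N.

Let G := cm_g S b.
Let phi := cm_phi S b.
Let xi := cm_xi S b.
Let eta := cm_eta S b.
Let rG : riemannian (img b) G := riemannian_chart (cm_g S) b.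

(** The exterior derivative is skew; constant fields extend the vectors. *)
Lemma contact_phi_skew y u v : img b y ->
  inner (G y) u (v *m phi y) = - inner (G y) v (u *m phi y).
Proof.
move=> Uy.
have Ccst (w : 'rV[R]_(n.*2.+1)) : smooth (img b) (fun=> w).
  by move=> k; exact: Ck_cst.
rewrite (cm_deta S (Ccst u) (Ccst v) Uy) (cm_deta S (Ccst v) (Ccst u) Uy).
rewrite /ext_deriv /lie_bracket !ddE !dd_cst subrr /pairing mul0mx mxE !subr0.
by rewrite -mulrN opprB.
Qed.

Lemma sasakian_chart (V : 'rV[R]_(n.*2.+1) -> 'rV[R]_(n.*2.+1)) y u :
  smooth (img b) V -> img b y ->
  cov G (fun z => V z *m phi z) y u - cov G V y u *m phi y =
  inner (G y) u (V y) *: xi y - pairing (eta y) (V y) *: u.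
Proof.
move=> CV Uy; have [Sas _] := space_form.
have Cu : smooth (img b) (fun=> u) by move=> k; exact: Ck_cst.
by have := Sas b _ V Cu CV y Uy; rewrite !covDE.
Qed.

Let phi2 := @cm_phi2 _ _ _ S b.
Let eta_xi := @cm_eta_xi _ _ _ S b.
Let compat := @cm_compat _ _ _ S b.
Let Cphi : smooth (img b) phi := endo_smooth (cm_phi S) b.
Let Cxi : smooth (img b) xi := vf_smooth (cm_xi S) b.

Lemma contact_eta_inner y u : img b y ->
  pairing (eta y) u = inner (G y) u (xi y).
Proof. exact: (eta_inner rG phi2 eta_xi compat contact_phi_skew). Qed.

Variables (M : manifold R n) (g : metric M) (iota : M -> N).
Hypotheses (M_integral : integral_submanifold S iota).
Hypothesis g_induced : induced_metric g (cm_g S) iota.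

Lemma integral_max a x (D : set 'rV[R]_n) :
  (n%:R + 3) * c + 3 * n%:R - 3 <= 0 ->
  open D -> D `<=` local_dom iota a b -> D x ->
  (forall y, D y ->
    tau_sq g (cm_g S) iota a b y <= tau_sq g (cm_g S) iota a b x) ->
  bitension (g a) G (local_map iota a b) x = 0 ->
  tau (g a) G (local_map iota a b) x = 0.
Proof.
have [[Ciota _ _] horiz] := M_integral; have [_ sectional_c] := space_form.
move=> c_le oD DU Dx Fmax bi.
refine (@legendrian_max _ _ _ _ _ _ phi _ xi c
  (riemannian_local_dom g Ciota a b) rG
  (@smooth_local_map _ _ _ _ _ _ Ciota a b) (@local_map_img _ _ _ _ _ iota a b)
  (@local_map_isometric _ _ _ _ _ _ _ _ g_induced a b) Cxi
  _ _ _ _ _ _ _ x D c_le oD DU Dx Fmax bi).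
- exact: (xi_unit rG phi2 eta_xi compat contact_phi_skew).
- by move=> y u; exact: (phi_xi_orth rG phi2 eta_xi contact_phi_skew).
- exact: contact_phi_skew.
- move=> y u v Uy v0.
  by rewrite (compat u v Uy) (contact_eta_inner v Uy) v0 mulr0 subr0.
- exact: (cov_xi rG Cxi phi2 eta_xi compat contact_phi_skew sasakian_chart).
- exact: (sasakian_rm rG Cphi Cxi phi2 eta_xi compat contact_phi_skew
    sasakian_chart (@sectional_c b)).
- move=> y u Uy; rewrite -contact_eta_inner; last exact: local_map_img Uy.
  by rewrite -ddE; exact: horiz.
Qed.

End SasakianManifold.

Theorem corollary3p3 (R : realType) (n : nat) (n_gt0 : (0 < n)%N)
    (N : manifold R n.*2.+1) (S : contact_metric N) (c : R)
    (N_space_form : sasakian_space_form S c)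
    (c_le : c <= (3 - 3 * n%:R) / (n%:R + 3))
    (M : manifold R n) (M_compact : compact [set: M])
    (g : metric M) (iota : M -> N)
    (M_integral : integral_submanifold S iota)
    (g_induced : induced_metric g (cm_g S) iota) :
  biharmonic g (cm_g S) iota <-> minimal g (cm_g S) iota.
Proof.
have [[Ciota _ _] _] := M_integral.
have rG a b := riemannian_local_dom g Ciota a b.
have rH b := riemannian_chart (cm_g S) b.
have Cf a b := @smooth_local_map _ _ _ M N iota Ciota a b.
have fU a b := @local_map_img _ _ _ M N iota a b.
have iso a b := @local_map_isometric _ _ _ M N g (cm_g S) iota g_induced a b.
have mcE a b x : local_dom iota a b x ->
    mean_curvature (g a) (cm_g S b) (local_map iota a b) x =
    n%:R^-1 *: tau (g a) (cm_g S b) (local_map iota a b) x.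
  exact: (mean_curvatureE (rG a b) (rH b) (Cf a b) (fU a b) (@iso a b)).
split=> [bih a b x Dx|min a b x Dx]; last first.
  have tau0 y : local_dom iota a b y ->
      tau (g a) (cm_g S b) (local_map iota a b) y = 0.
    move=> Dy; have /eqP := min a b y Dy;
      rewrite mcE// scaler_eq0 invr_eq0 pnatr_eq0.
    by rewrite -leqn0 leqNgt n_gt0 => /eqP.
  exact: (harmonic_biharmonic (rG a b) (rH b) (fU a b) tau0 Dx).
have c_le0 : (n%:R + 3) * c + 3 * n%:R - 3 <= 0.
  have n3 : 0 < n%:R + 3 :> R by rewrite ltr_wpDl.
  by move: c_le; rewrite ler_pdivlMr//; lra.
pose F := tension_sq g (cm_g S) iota.
(* The extreme value theorem needs a point; the one where minimality is to be shown serves. *)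
have M0 : [set: M] !=set0 by exists (point M a x).
have [|p _ Fmax] := @compact_EVT_max M R F setT M0 M_compact.
  apply: continuous_subspaceT; exact: tension_sq_continuous.
have FE q a' b' : dom M a' q -> dom N b' (iota q) ->
    F q = tau_sq g (cm_g S) iota a' b' (coord M a' q).
  by move=> ? ?; exact: tension_sqE.
set a0 := some_chart p; set b0 := some_chart (iota p).
have [pa pb] := (some_chartP p : dom M a0 p, some_chartP (iota p) : dom N b0 _).
have Dp : local_dom iota a0 b0 (coord M a0 p).
  by split; [exists p|rewrite coordK].
(* The global maximum is one on the local domain of the charts at [p], so [integral_max] applies
   there. *)
have Fp : F p = 0.
  have Dmax y : local_dom iota a0 b0 y ->
      tau_sq g (cm_g S) iota a0 b0 y <=
      tau_sq g (cm_g S) iota a0 b0 (coord M a0 p).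
    move=> [ay by_]; have [qa qy] := point_coord ay.
    by rewrite -(FE p a0 b0 pa pb) -{1}qy -(FE _ a0 b0 qa by_) Fmax// inE.
  have t0 := integral_max N_space_form M_integral g_induced c_le0
    (riemannian_open (rG a0 b0)) (fun _ => id) Dp Dmax (bih _ _ _ Dp).
  by rewrite (FE p a0 b0 pa pb) /tau_sq t0 inner0l.
rewrite mcE//; apply/eqP; rewrite scaler_eq0; apply/orP; right.
have [ax bx] := Dx; have [qa qx] := point_coord ax.
(* A nonzero tension at [x] would give [F] a value above its maximum 0. *)
apply: contraT => /(riemannian_pos (rH b) (fU a b x Dx)).
have := Fmax (point M a x); rewrite inE Fp (FE _ a b)// qx => /(_ I).
by rewrite /tau_sq leNgt => /negbTE ->.
Qed.
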